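(* Let $\{\boldsymbol{y}_1,\dots,\boldsymbol{y}_n\}$ be a scrambled $(\lambda,t,m,d)$-net in base $b$ with $n=\lambda b^m$, and suppose $0<M<1/2$. With $\widehat I_n(h_{\mathrm{IS}})=\frac1n\sum_{j=1}^n h_{\mathrm{IS}}\circ F^{-1}(\boldsymbol{y}_j)$, we have $$\sup_{(h,\tau)\in V_p(k)}\mathbb{E}\left[\left(\widehat I_n(h_{\mathrm{IS}})-\mathbb{E}[h(W)]\right)^2\right]=O\left(n^{-3}(\log n)^{(k+1)d}\right),$$ and $$\sup_{(h,\tau)\in V_e(k)}\mathbb{E}\left[\left(\widehat I_n(h_{\mathrm{IS}})-\mathbb{E}[h(W)]\right)^2\right]=O\left(n^{-3}(\log n)^{d}\exp\left\{2dM_2\left(\frac{3\log n}{1-2M}\right)^{\frac k2}\right\}\right).$$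
   Context: $W$ is a standard normal random vector in $\mathbb{R}^d$ with density $\varphi$. $\tau=(\tau_1,\dots,\tau_d)$ is a random vector in $\mathbb{R}^d$ with independent components and density $g(\boldsymbol{x})=\prod_{j=1}^d g_j(x_j)$, where $g_j$ is the marginal density of $\tau_j$; $F_j$ is the distribution function of $\tau_j$, and $F^{-1}(\boldsymbol{y})=(F_1^{-1}(y_1),\dots,F_d^{-1}(y_d))$. $h_{\mathrm{IS}}:=\varphi h/g$ is the weighted function obtained after importance sampling, so that $\mathbb{E}[h(W)]=\mathbb{E}[h_{\mathrm{IS}}(\tau)]$. $|\cdot|$ is the Euclidean norm; $1{:}d=\{1,\dots,d\}$; $\partial^{\boldsymbol{u}}$ is the mixed partial derivative taken once with respect to each $x_j$, $j\in\boldsymbol{u}$. $\mathcal{S}^d(\mathbb{R}^d)$ is the class of functions $f$ on $\mathbb{R}^d$ with $\partial^{\boldsymbol{u}}f$ continuous for all $\boldsymbol{u}\subseteq1{:}d$. For $M>0$, $B>0$, $G_e(M,B,2)=\{f\in\mathcal{S}^d(\mathbb{R}^d):\sup_{\boldsymbol{u}\subseteq1{:}d}|\partial^{\boldsymbol{u}}f(\boldsymbol{x})|\le Be^{M|\boldsymbol{x}|^2}\ \text{for all }\boldsymbol{x}\}$. For $k>0$ and positive constants $B,A,M_1,B_1,M_2,B_2$, define the sets of pairs $$V_p(k)=\left\{(h,\tau):\ h/g\in G_e(M,B,2),\ \max_{1\le j\le d}\tfrac{1}{g_j(x)}\le M_1|x|^k+B_1,\ \mathbb{E}|\tau|^2\le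 A\right\},$$ $$V_e(k)=\left\{(h,\tau):\ h/g\in G_e(M,B,2),\ \max_{1\le j\le d}\tfrac{1}{g_j(x)}\le B_2e^{M_2|x|^k},\ \mathbb{E}|\tau|^2\le A\right\},$$ where the bounds on $1/g_j(x)$ are for all $x\in\mathbb{R}$. Nets: an elementary interval in base $b\ge2$ is a set $\prod_{j=1}^d[t_jb^{-k_j},(t_j+1)b^{-k_j})$ with integers $k_j\ge0$, $0\le t_j<b^{k_j}$. For integers $m\ge0$, $0\le t\le m$, $1\le\lambda<b$, a set of $\lambda b^m$ points is a $(\lambda,t,m,d)$-net in base $b$ if every elementary interval of volume $b^{t-m}$ contains $\lambda b^t$ of the points and no elementary interval of volume $b^{t-m-1}$ contains more than $b^t$ of them. A scrambled net is the result of applying Owen's nested uniform scrambling to such a net: each point's $j$-th coordinate $\sum_{i\ge1}a_ib^{-i}$ (base-$b$ digits $a_i$) is replaced by $\sum_{i\ge1}x_ib^{-i}$ with $x_1=\pi_j(a_1)$, $x_i=\pi_{j;a_1,\dots,a_{i-1}}(a_i)$ for $i\ge2$, where all the $\pi$'s are mutually independent uniformly random permutations of $\{0,\dots,b-1\}$, the same for all points of the net. The scrambled points are each uniform on $[0,1]^d$ and form a $(\lambda,t,m,d)$-net with probability 1. The $O$ is as $m\to\infty$ (so $n\to\infty$) with $b,\lambda,t,d$ and all other constants fixed. *)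

(* Defs.v *)
From mathcomp Require Import all_boot all_order all_algebra all_fingroup.
From mathcomp Require Import all_classical all_reals all_analysis.
Set Implicit Arguments.
Unset Strict Implicit.
Unset Printing Implicit Defensive.
Import Order.TTheory GRing.Theory Num.Theory.
Import numFieldNormedType.Exports.
Local Open Scope classical_set_scope.
Local Open Scope ring_scope.

(* The library norm of 'rV[R]_d is the sup norm, hence this definition. *)
Definition enorm (R : realType) (d : nat) (x : 'rV[R]_d) : R :=
  Num.sqrt (\sum_(j < d) x 0 j ^+ 2).

Definition partial (R : realType) (d : nat) (j : 'I_d) (f : 'rV[R]_d -> R)
  : 'rV[R]_d -> R := fun x => 'D_(delta_mx 0 j) f x.

Definition mixed_partial (R : realType) (d : nat) (u : {set 'I_d})
    (f : 'rV[R]_d -> R) : 'rV[R]_d -> R :=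
  foldr (@partial R d) f (enum u).

(* [partial] is a total function, so the existence of the derivatives has to be
   required separately from their continuity.  Under the continuity requirement
   the order of differentiation is irrelevant by Schwarz's theorem. *)
Definition smooth_mixed (R : realType) (d : nat) : set ('rV[R]_d -> R) :=
  [set f | forall u : {set 'I_d}, continuous (mixed_partial u f) /\
    forall (j : 'I_d) (x : 'rV[R]_d), j \notin u ->
      derivable (mixed_partial u f) x (delta_mx 0 j)].

Definition Ge2 (R : realType) (d : nat) (M B : R) : set ('rV[R]_d -> R) :=
  [set f | smooth_mixed f /\ forall (u : {set 'I_d}) (x : 'rV[R]_d),
    `|mixed_partial u f x| <= B * expR (M * enorm x ^+ 2)].

(* [G] plays the role of the measurable subsets of the common codomain [U]. *)
Definition mutually_independent (R : realType) (dT : measure_display)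
    (T : measurableType dT) (P : probability T R) (I : eqType) (U : Type)
    (G : set (set U)) (X : I -> T -> U) : Prop :=
  forall (s : seq I) (A : I -> set U), uniq s ->
    (forall i, i \in s -> G (A i)) ->
    P (\big[setI/setT]_(i <- s) (X i @^-1` A i)) =
    (\prod_(i <- s) P (X i @^-1` A i))%E.

Definition rvec (R : realType) (d : nat) (dT : measure_display)
    (T : measurableType dT) (P : probability T R)
    (X : 'I_d -> {RV P >-> R}) (w : T) : 'rV[R]_d :=
  \row_j X j w.

Definition standard_normal_vector (R : realType) (d : nat)
    (dT : measure_display) (T : measurableType dT) (P : probability T R)
    (W : 'I_d -> {RV P >-> R}) : Prop :=
  mutually_independent P (@measurable _ R) (fun j => W j : T -> R) /\
  forall (j : 'I_d) (A : set R), measurable A ->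
    distribution P (W j) A = normal_prob 0 1 A.

Definition phi (R : realType) (d : nat) (x : 'rV[R]_d) : R :=
  (2 * pi) `^ (- (d%:R / 2)) * expR (- (enorm x ^+ 2 / 2)).

(* A random vector [tau] with independent components, on a probability space of
   its own, together with a version [g j] of the density of [tau j]. *)
Record density_vector (R : realType) (d : nat) := DensityVector {
  dv_display : measure_display;
  dv_space : measurableType dv_display;
  dv_prob : probability dv_space R;
  tau : 'I_d -> {RV dv_prob >-> R};
  g : 'I_d -> R -> R;
  tau_independent :
    mutually_independent dv_prob (@measurable _ R)
      (fun j => tau j : dv_space -> R);
  g_ge0 : forall j x, 0 <= g j x;
  g_measurable : forall j, measurable_fun setT (g j);
  g_density : forall (j : 'I_d) (A : set R), measurable A ->
    distribution dv_prob (tau j) A =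
    (\int[lebesgue_measure]_(x in A) (g j x)%:E)%E
}.

Definition joint_density (R : realType) (d : nat) (D : density_vector R d)
    (x : 'rV[R]_d) : R := \prod_(j < d) g D j (x 0 j).

Definition second_moment (R : realType) (d : nat) (D : density_vector R d)
    : \bar R :=
  ('E_(dv_prob D)[fun w => (enorm (rvec (tau D) w) ^+ 2)%R])%E.

(* The generalized inverse, which is the inverse of [F_j] on ]0, 1[ when [F_j]
   is continuous and strictly increasing. *)
Definition quantile (R : realType) (d : nat) (D : density_vector R d)
    (j : 'I_d) (y : R) : R :=
  inf [set x : R | (y%:E <= cdf (tau D j) x)%E].

Definition Finv (R : realType) (d : nat) (D : density_vector R d)
    (y : 'rV[R]_d) : 'rV[R]_d := \row_j quantile D j (y 0 j).

Definition h_over_g (R : realType) (d : nat) (h : 'rV[R]_d -> R)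
    (D : density_vector R d) : 'rV[R]_d -> R :=
  fun x => h x / joint_density D x.

Definition hIS (R : realType) (d : nat) (h : 'rV[R]_d -> R)
    (D : density_vector R d) : 'rV[R]_d -> R :=
  fun x => phi x * h x / joint_density D x.

(* As [0^-1 = 0] here, a finite upper bound on [1 / g_j(x)] has to come with
   the positivity of [g_j(x)]. *)
Definition V_p (R : realType) (d : nat) (M B A M1 B1 k : R)
    (h : 'rV[R]_d -> R) (D : density_vector R d) : Prop :=
  [/\ Ge2 M B (h_over_g h D),
      forall (j : 'I_d) (x : R),
        0 < g D j x /\ (g D j x)^-1 <= M1 * `|x| `^ k + B1
    & (second_moment D <= A%:E)%E].

Definition V_e (R : realType) (d : nat) (M B A M2 B2 k : R)
    (h : 'rV[R]_d -> R) (D : density_vector R d) : Prop :=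
  [/\ Ge2 M B (h_over_g h D),
      forall (j : 'I_d) (x : R),
        0 < g D j x /\ (g D j x)^-1 <= B2 * expR (M2 * `|x| `^ k)
    & (second_moment D <= A%:E)%E].

Definition in_elementary (R : realType) (d b : nat) (k a : 'I_d -> nat)
    (x : 'rV[R]_d) : bool :=
  [forall j, (a j)%:R / b%:R ^+ k j <= x 0 j < (a j).+1%:R / b%:R ^+ k j].

Definition elementary_volume (R : realType) (d b : nat) (k : 'I_d -> nat) : R :=
  \prod_(j < d) b%:R ^- k j.

(* Points are counted with multiplicity. *)
Definition is_net (R : realType) (d b lam t m : nat)
    (x : 'I_(lam * b ^ m) -> 'rV[R]_d) : Prop :=
  [/\ (t <= m)%N,
      forall i j, 0 <= x i 0 j < 1,
      forall k a : 'I_d -> nat, (forall j, (a j < b ^ k j)%N) ->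
        elementary_volume R b k = b%:R ^ (t%:Z - m%:Z) ->
        #|[pred i | in_elementary b k a (x i)]| = (lam * b ^ t)%N
    & forall k a : 'I_d -> nat, (forall j, (a j < b ^ k j)%N) ->
        elementary_volume R b k = b%:R ^ (t%:Z - m%:Z - 1) ->
        (#|[pred i | in_elementary b k a (x i)]| <= b ^ t)%N].

(* The [i]-th base-[b] digit ([i >= 1]) of [x] in [0, 1[; for [b]-adic
   rationals this selects the terminating expansion. *)
Definition digit (R : realType) (b : nat) (hb : (1 < b)%N) (x : R) (i : nat)
    : 'I_b :=
  Ordinal (ltn_pmod (Num.truncn (x * b%:R ^+ i)) (ltnW hb)).

(* [perms s] is the permutation applied to the digit that follows the prefix [s];
   in particular [perms [::]] acts on the first digit. *)
Definition scramble_coord (R : realType) (b : nat) (hb : (1 < b)%N)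
    (perms : seq 'I_b -> 'S_b) (x : R) : R :=
  limn (fun N => \sum_(1 <= i < N.+1)
    (perms [seq digit hb x l | l <- iota 1 i.-1] (digit hb x i))%:R
      / b%:R ^+ i : R).

Definition scramble (R : realType) (d b : nat) (hb : (1 < b)%N)
    (perms : 'I_d * seq 'I_b -> 'S_b) (x : 'rV[R]_d) : 'rV[R]_d :=
  \row_j scramble_coord hb (fun s => perms (j, s)) (x 0 j).

Definition uniform_permutations (R : realType) (d b : nat)
    (dT : measure_display) (T : measurableType dT) (P : probability T R)
    (perms : 'I_d * seq 'I_b -> T -> 'S_b) : Prop :=
  [/\ forall js (s : 'S_b), measurable (perms js @^-1` [set s]),
      forall js (s : 'S_b), P (perms js @^-1` [set s]) = ((b`!)%:R^-1 : R)%:E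
    & mutually_independent P setT perms].

Definition IS_estimator (R : realType) (d n : nat) (h : 'rV[R]_d -> R)
    (D : density_vector R d) (y : 'I_n -> 'rV[R]_d) : R :=
  n%:R^-1 * \sum_(i < n) hIS h D (Finv D (y i)).

Definition scrambled_mse (R : realType) (d b n : nat) (hb : (1 < b)%N)
    (dT : measure_display) (T : measurableType dT) (P : probability T R)
    (perms : 'I_d * seq 'I_b -> T -> 'S_b) (x : 'I_n -> 'rV[R]_d)
    (dW : measure_display) (TW : measurableType dW) (PW : probability TW R)
    (W : 'I_d -> {RV PW >-> R})
    (h : 'rV[R]_d -> R) (D : density_vector R d) : \bar R :=
  let EhW : R := fine ('E_PW[fun v => h (rvec W v)])%E in
  ('E_P[fun w =>
    ((IS_estimator h D (fun i => scramble hb (fun js => perms js w) (x i))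
      - EhW) ^+ 2)%R])%E.

(* The supremum of the mean squared error over the pairs [(h, tau)] in [V]. *)
Definition sup_scrambled_mse (R : realType) (d b n : nat) (hb : (1 < b)%N)
    (dT : measure_display) (T : measurableType dT) (P : probability T R)
    (perms : 'I_d * seq 'I_b -> T -> 'S_b) (x : 'I_n -> 'rV[R]_d)
    (dW : measure_display) (TW : measurableType dW) (PW : probability TW R)
    (W : 'I_d -> {RV PW >-> R})
    (V : ('rV[R]_d -> R) -> density_vector R d -> Prop) : \bar R :=
  ereal_sup [set v | exists (h : 'rV[R]_d -> R) (D : density_vector R d),
    V h D /\ v = scrambled_mse hb P perms x W h D].

(* Main.v *)
Require Import Defs.
From mathcomp Require Import all_boot all_order all_algebra all_fingroup.
From mathcomp Require Import all_classical all_reals all_analysis.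
From mathcomp Require Import measurable_realfun.
From mathcomp Require Import ring lra zify.
Set Implicit Arguments.
Unset Strict Implicit.
Unset Printing Implicit Defensive.
Import Order.TTheory GRing.Theory Num.Theory.
Import numFieldNormedType.Exports.
Local Open Scope classical_set_scope.
Local Open Scope ring_scope.

(** Write q = h / g and f = phi q, so that h_IS = f.  Since q and its mixed
    derivatives are at most B exp(M |x|^2) with M < 1/2, the mixed derivatives
    of f are bounded and f itself is at most C exp(-(1/2 - M) |x|^2)
    ([gauss_mul_mixed_bound], [gauss_mul_bound]).

    Truncation.  Every quantile function is clipped to [-r, r], where
    r^2 = 3 ln n / (1 - 2 M).  Clipping changes f o F^-1 only at points where
    both values are at most C exp(-(1/2 - M) r^2) = C n^(-3/2)
    ([integrand_clip]), so it contributes O(n^-3) to the mean squared error,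
    pointwise and without any probability.  The clipped quantiles are Lipschitz
    with constant L = sup 1/g_j over [-r, r] ([clipped_quantile_lip]).  This is
    the only place where the growth of 1/g_j matters, and it produces the
    factor L^(2 d) in the final rate.

    Discretization.  With N = 4 (m + 1) digits per coordinate, replacing a
    scrambled point by its base-b cell costs O(L b^-N), which is negligible, and
    the problem becomes finite: a function H on cells and a uniformly random
    finite family of permutations ([integral_family]).

    Variance.  H is the sum of its tensor Haar components H_k, where k gives a
    number of digits for every coordinate.  Three facts bound the variance in
    [net_variance].
    - The net integrates H_k exactly if k is not 0 and |k| <= m - t, because a
      scrambled net puts the same number of points in every cell of that shape
      ([net_integrates_coarse]).
    - The values of H_k and H_k' at two scrambled points are uncorrelated unless
      k = k' and the points share all but the last of the k_j leading digits in
      every coordinate ([scrambled_components_orthogonal]); a net point has a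
      bounded number of such partners ([net_count]).
    - |H_k| <= C L^d b^(-|k|), because H_k is an average of mixed differences of
      f over boxes with sides of length at most L b^(1 - k_j)
      ([tensor_bound], [haar_component_cell_value]).
    Hence each of the (N + 1)^d components contributes at most
    C L^(2 d) b^(-2 (m - t)) / n, and the sum is O(n^-3 (ln n)^d L^(2 d)).

    Mean.  Under the weight g / phi the law of W becomes the law of tau, under
    which the F_j are independent uniform variables; so E[h(W)] is within the
    two errors above of the mean of H over all cells ([mean_cell_value]).

    It remains to insert L = M1 r^k + B1 or L = B2 exp(M2 r^k). *)

(** * Haar components of functions on base-b cells *)

Section Haar.
Variables (R : realFieldType) (b N : nat).
Hypothesis hb : (1 < b)%N.

Definition agree (l : nat) (y c : {ffun 'I_N -> 'I_b}) : bool :=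
  [forall i : 'I_N, (i < l)%N ==> (y i == c i)].

(** The kernel, with respect to counting measure, of the averaging operator E_l
    that replaces a function by its means over the cells of l leading digits. *)
Definition avg_kernel (l : nat) (y c : {ffun 'I_N -> 'I_b}) : R :=
  b%:R ^+ l / b%:R ^+ N * (agree l y c)%:R.

(** The kernel of the martingale difference E_l - E_(l-1). *)
Definition haar_kernel (l : nat) (y c : {ffun 'I_N -> 'I_b}) : R :=
  if l is l'.+1 then avg_kernel l'.+1 y c - avg_kernel l' y c else avg_kernel 0 y c.

Lemma agreeP l (y c : {ffun 'I_N -> 'I_b}) :
  reflect (forall i : 'I_N, (i < l)%N -> y i = c i) (agree l y c).
Proof.
apply: (iffP forallP) => [H i il|H i]; first by apply/eqP; exact: (implyP (H i)).
by apply/implyP => il; rewrite H.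
Qed.

Lemma agree_sym l y c : agree l y c = agree l c y.
Proof. by apply/agreeP/agreeP => H i il; rewrite H. Qed.

Lemma agree_trans l x y c : agree l y x -> agree l x c -> agree l y c.
Proof. by move=> /agreeP H /agreeP K; apply/agreeP => i il; rewrite H// K. Qed.

Lemma agree_le l l' y c : (l <= l')%N -> agree l' y c -> agree l y c.
Proof. by move=> ll /agreeP H; apply/agreeP => i il; rewrite H// (leq_trans il). Qed.

Lemma agree_congr l x y c : agree l x y -> agree l x c = agree l y c.
Proof.
move=> xy; apply/idP/idP; apply: agree_trans => //.
by rewrite agree_sym.
Qed.

Lemma agree_full y c : agree N y c = (y == c).
Proof.
apply/agreeP/eqP => [H|-> //]; apply/ffunP => i; exact: H.
Qed.

Lemma agree0 y c : agree 0 y c.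
Proof. exact/agreeP. Qed.

Lemma agreeS l (lN : (l < N)%N) y c :
  agree l.+1 y c = agree l y c && (y (Ordinal lN) == c (Ordinal lN)).
Proof.
apply/agreeP/andP => [H|[/agreeP H /eqP E] i].
  split; last by rewrite H.
  by apply/agreeP => i il; rewrite H // ltnW.
rewrite ltnS leq_eqVlt => /predU1P[il|]; last exact: H.
by rewrite (_ : i = Ordinal lN) //; exact: val_inj.
Qed.

Let b0 : (b%:R : R) != 0.
Proof. by rewrite pnatr_eq0 -lt0n ltnW. Qed.

Let bp : (0 : R) < b%:R.
Proof. by rewrite ltr0n ltnW. Qed.

Lemma avg_kernel_ge0 l y c : 0 <= avg_kernel l y c.
Proof. by rewrite mulr_ge0 // mulr_ge0 ?invr_ge0 ?exprn_ge0 // ltW. Qed.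

Lemma avg_kernel_sym l y c : avg_kernel l y c = avg_kernel l c y.
Proof. by rewrite /avg_kernel agree_sym. Qed.

Lemma haar_kernel_sym l y c : haar_kernel l y c = haar_kernel l c y.
Proof. by case: l => [|l] /=; rewrite avg_kernel_sym // (avg_kernel_sym l). Qed.

Lemma avg_kernel_prod l y c : (l <= N)%N ->
  avg_kernel l y c = \prod_(i < N) (if (i < l)%N then (y i == c i)%:R else b%:R^-1).
Proof.
move=> lN; rewrite /avg_kernel; case: (boolP (agree l y c)) => [/agreeP H|].
  rewrite (eq_bigr (fun i : 'I_N => if (i < l)%N then 1 else b%:R^-1)); last first.
    by move=> i _; case: ifPn => // il; rewrite H ?eqxx.
  rewrite -(big_mkord xpredT (fun i => if (i < l)%N then 1 else b%:R^-1 : R)).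
  rewrite (big_cat_nat _ lN) //= big_nat_cond big1 ?mul1r; last first.
    by move=> i; rewrite andbT /= => ->.
  rewrite big_nat_cond (eq_bigr (fun=> b%:R^-1)); last first.
    by move=> i /andP[/andP[li _] _]; rewrite ltnNge li.
  rewrite -big_nat_cond prodr_const_nat mulr1 -{1}(subnK lN) exprD exprVn.
  by rewrite invfM mulrCA divff ?mulr1 // expf_neq0.
rewrite negb_forall => /existsP[i]; rewrite negb_imply => /andP[il yc].
by rewrite mulr0 (bigD1 i) //= il (negPf yc) mul0r.
Qed.

Lemma sum_avg_kernel l y : (l <= N)%N -> \sum_c avg_kernel l y c = 1.
Proof.
move=> lN; under eq_bigr => c _ do rewrite avg_kernel_prod //.
rewrite -(bigA_distr_bigA (fun (i : 'I_N) (a : 'I_b) =>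
  if (i < l)%N then (y i == a)%:R else b%:R^-1 : R)).
apply: big1 => i _; case: (i < l)%N.
  rewrite (bigD1 (y i)) //= eqxx big1 ?addr0 // => a /negPf.
  by rewrite eq_sym => ->.
by rewrite sumr_const card_ord -[RHS](mulVf b0) mulr_natr.
Qed.

Lemma sum_haar_kernel l y : (0 < l <= N)%N -> \sum_c haar_kernel l y c = 0.
Proof.
case: l => // l /andP[_ lN] /=.
by rewrite sumrB !sum_avg_kernel ?subrr // ltnW.
Qed.

Lemma sum_haar_kernel_norm l y : (l <= N)%N -> \sum_c `|haar_kernel l y c| <= 2.
Proof.
case: l => [|l] lN /=.
  under eq_bigr => c _ do rewrite ger0_norm ?avg_kernel_ge0 //.
  by rewrite sum_avg_kernel // ler1n.
apply: (@le_trans _ _ (\sum_c (avg_kernel l.+1 y c + avg_kernel l y c))).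
  apply: ler_sum => c _; rewrite (le_trans (ler_normB _ _)) //.
  by rewrite !ger0_norm ?avg_kernel_ge0.
by rewrite big_split /= !sum_avg_kernel // ltnW.
Qed.

Lemma haar_kernel_support l y c : haar_kernel l y c != 0 -> agree l.-1 y c.
Proof.
case: l => [|l] /=; first by rewrite agree0.
apply: contra_neqT => lyc.
have l1 : agree l.+1 y c = false.
  by apply: contraNF lyc; exact: agree_le.
by rewrite /avg_kernel (negPf lyc) l1 !mulr0 subrr.
Qed.

Lemma avg_kernel_congr l y y' c : agree l y y' -> avg_kernel l y c = avg_kernel l y' c.
Proof. by move=> H; rewrite /avg_kernel (agree_congr _ H). Qed.

Lemma haar_kernel_congr l y y' c : agree l y y' -> haar_kernel l y c = haar_kernel l y' c.
Proof.
case: l => [|l] H /=; first exact: avg_kernel_congr.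
by rewrite (avg_kernel_congr _ H) (avg_kernel_congr (l := l) _ (agree_le (leqnSn l) H)).
Qed.

Lemma telescope_haar_kernel y c : \sum_(l < N.+1) haar_kernel l y c = (y == c)%:R.
Proof.
have H m : \sum_(l < m.+1) haar_kernel l y c = avg_kernel m y c.
  elim: m => [|m IH]; first by rewrite big_ord1.
  by rewrite big_ord_recr IH /= addrC subrK.
by rewrite H /avg_kernel agree_full divff ?mul1r // expf_neq0.
Qed.

Definition set_digit (y : {ffun 'I_N -> 'I_b}) (i : 'I_N) (a : 'I_b) :=
  [ffun k => if k == i then a else y k].

Lemma agree_set_digit l y (i : 'I_N) a : (l <= i)%N -> agree l (set_digit y i a) y.
Proof.
move=> li; apply/agreeP => k kl; rewrite ffunE; case: eqP => // ki.
by move: kl; rewrite ki ltnNge li.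
Qed.

(** Averaging over the digit of index i turns E_(i+1) into E_i.  This
    cancellation is what makes components of scrambled points uncorrelated. *)
Lemma sum_digit_haar_kernel (i : 'I_N) y c :
  \sum_(a < b) haar_kernel i.+1 (set_digit y i a) c = 0.
Proof.
rewrite /= sumrB.
rewrite [X in _ - X](eq_bigr (fun=> avg_kernel i y c)); last first.
  by move=> a _; apply: avg_kernel_congr; exact: agree_set_digit.
rewrite sumr_const card_ord.
rewrite (eq_bigr (fun a => b%:R * avg_kernel i y c * (a == c i)%:R)); last first.
  move=> a _; rewrite /avg_kernel (agreeS (ltn_ord i)).
  rewrite (agree_congr _ (agree_set_digit _ _ (leqnn i))).
  rewrite (_ : Ordinal (ltn_ord i) = i) ?ffunE ?eqxx; last exact: val_inj.
  by rewrite -mulnb natrM exprS; ring.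
rewrite (bigD1 (c i)) //= eqxx big1 ?addr0; last first.
  by move=> a /negPf ->; rewrite mulr0.
by rewrite mulr1 mulr_natl subrr.
Qed.

Section Product.
Variable d : nat.

Local Notation cells := {ffun 'I_d -> {ffun 'I_N -> 'I_b}}.
Local Notation levels := {ffun 'I_d -> 'I_N.+1}.

Definition cells_agree (k : 'I_d -> nat) (y c : cells) : bool :=
  [forall j, agree (k j) (y j) (c j)].

(** The tensor product over j of the operators E_(k j) - E_(k j - 1) applied
    to H. *)
Definition haar_component (H : cells -> R) (k : 'I_d -> nat) (y : cells) : R :=
  \sum_c H c * \prod_j haar_kernel (k j) (y j) (c j).

Definition cell_mean (H : cells -> R) : R := (\sum_c H c) / #|cells|%:R.

Lemma cells_agreeP k (y c : cells) :
  reflect (forall j, agree (k j) (y j) (c j)) (cells_agree k y c).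
Proof. exact: forallP. Qed.

(** Expanding the product over j of the telescoping sums over the level of
    coordinate j leaves the kernel of the identity. *)
Lemma haar_component_decomp H y : \sum_(k : levels) haar_component H (fun j => k j) y = H y.
Proof.
rewrite exchange_big /= (bigD1 y) //= [X in _ + X]big1 ?addr0.
  rewrite -mulr_sumr -(bigA_distr_bigA (fun j (l : 'I_N.+1) => haar_kernel l (y j) (y j))).
  by rewrite big1 ?mulr1 // => j _; rewrite telescope_haar_kernel eqxx.
move=> c cy; rewrite -mulr_sumr.
rewrite -(bigA_distr_bigA (fun j (l : 'I_N.+1) => haar_kernel l (y j) (c j))).
have [j yc] : exists j, y j != c j.
  apply/existsP; apply: contraNT cy; rewrite negb_exists => /forallP E.
  by apply/eqP/ffunP => j; apply/esym/eqP; have := E j; rewrite negbK.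
by rewrite (bigD1 j) //= telescope_haar_kernel (negPf yc) mul0r mulr0.
Qed.

Lemma card_cells : #|cells|%:R = (b%:R ^+ N) ^+ d :> R.
Proof. by rewrite card_ffun card_ffun !card_ord !natrX. Qed.

Lemma haar_component0 H y : haar_component H (fun=> 0%N) y = cell_mean H.
Proof.
rewrite /haar_component /cell_mean mulr_suml; apply: eq_bigr => c _; congr (_ * _).
under eq_bigr do rewrite /= /avg_kernel agree0 mulr1 expr0 mul1r.
by rewrite prodr_const card_ord card_cells exprVn.
Qed.

Lemma haar_component_congr H k y y' : cells_agree k y y' ->
  haar_component H k y = haar_component H k y'.
Proof.
move=> /cells_agreeP E; apply: eq_bigr => c _; congr (_ * _).
by apply: eq_bigr => j _; exact: haar_kernel_congr.
Qed.

Lemma sum_haar_component H k : (forall j, k j <= N)%N -> (exists j, 0 < k j)%N ->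
  \sum_y haar_component H k y = 0.
Proof.
move=> kN [j kj]; rewrite /haar_component exchange_big big1 //= => c _.
rewrite -mulr_sumr -(bigA_distr_bigA (fun j y => haar_kernel (k j) y (c j))).
rewrite (bigD1 j) //= (_ : \sum_y _ = 0) ?mul0r ?mulr0 //.
under eq_bigr do rewrite haar_kernel_sym.
by rewrite sum_haar_kernel // kj kN.
Qed.

End Product.
End Haar.

(** * Nested uniform scrambling as a random family of permutations *)

Section Scrambling.
Variables (R : realFieldType) (d b N : nat).
Hypothesis hb : (1 < b)%N.

Local Notation column := {ffun 'I_N -> 'I_b}.
Local Notation cells := {ffun 'I_d -> {ffun 'I_N -> 'I_b}}.
Local Notation keys := ('I_d * N.-bseq 'I_b)%type.
Local Notation family := {ffun 'I_d * N.-bseq 'I_b -> 'S_b}.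

Definition prefix_of (i : nat) (y : column) : seq 'I_b :=
  [seq y k | k : 'I_N <- enum 'I_N & (k < i)%N].

Definition key (i : nat) (y : column) : N.-bseq 'I_b :=
  insub_bseq N (prefix_of i y).

(** Only the permutations attached to prefixes of fewer than N digits act on the
    first N digits, so scrambling a cell is governed by a point w of a finite
    probability space. *)
Definition scramble_cells (w : family) (a : cells) : cells :=
  [ffun j => [ffun i : 'I_N => w (j, key i (a j)) (a j i)]].

Lemma size_prefix_of i y : (i <= N)%N -> size (prefix_of i y) = i.
Proof.
move=> iN; rewrite size_map -(size_map val) -(filter_map val (fun k => k < i)%N).
rewrite val_enum_ord -[RHS](size_iota 0 i); congr size.
by rewrite -[RHS](filter_iota_ltn 0 iN).
Qed.

Lemma val_key i y : (i <= N)%N -> key i y = prefix_of i y :> seq 'I_b.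
Proof.
by move=> iN; rewrite /key /insub_bseq val_insubd size_prefix_of // iN.
Qed.

Lemma prefix_of_agree i (y c : column) :
  agree i y c -> prefix_of i y = prefix_of i c.
Proof.
move=> /agreeP H; apply/eq_in_map => k.
by rewrite mem_filter => /andP[ki _]; exact: H.
Qed.

Lemma key_agree i (y c : column) : agree i y c -> key i y = key i c.
Proof. by move=> /prefix_of_agree E; rewrite /key E. Qed.

Lemma key_inj i i' y y' : (i <= N)%N -> (i' <= N)%N -> key i y = key i' y' ->
  i = i' /\ agree i y y'.
Proof.
move=> iN iN' /(congr1 (fun s : N.-bseq 'I_b => s : seq 'I_b)).
rewrite !val_key // => E.
have ii : i = i' by rewrite -(size_prefix_of y iN) E size_prefix_of.
split => //; move: E; rewrite -ii => /eq_in_map E; apply/agreeP => k ki.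
by apply: E; rewrite mem_filter ki mem_enum.
Qed.

Lemma scramble_cells_agree w k (a a' : cells) :
  cells_agree k a a' -> cells_agree k (scramble_cells w a) (scramble_cells w a').
Proof.
move=> /cells_agreeP H; apply/cells_agreeP => j; apply/agreeP => i ik; rewrite !ffunE.
rewrite (key_agree (agree_le (ltnW ik) (H j))); congr (w _ _).
exact: (agreeP _ _ _ (H j)).
Qed.

Lemma scramble_cells_inj w : injective (scramble_cells w).
Proof.
move=> a a' E; apply/ffunP => j; apply/ffunP.
have H l : (l <= N)%N -> agree l (a j) (a' j).
  elim: l => [|l IH] lN; first exact: agree0.
  rewrite (agreeS lN) IH ?(ltnW lN) //=; apply/eqP.
  have /ffunP/(_ (Ordinal lN)) : scramble_cells w a j = scramble_cells w a' j by rewrite E.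
  rewrite !ffunE /= (key_agree (IH (ltnW lN))); exact: perm_inj.
by move=> i; exact: (agreeP _ _ _ (H N (leqnn N))).
Qed.

Lemma sum_scramble_cells w (th : cells -> R) : \sum_c th (scramble_cells w c) = \sum_c th c.
Proof. by rewrite [RHS](reindex_inj (@scramble_cells_inj w)). Qed.

(** The sum over permutations does not depend on x, by right multiplication with
    a transposition; summed over all x it is a multiple of the total of u. *)
Lemma sum_perm0 (u : 'I_b -> R) (x : 'I_b) :
  \sum_a u a = 0 -> \sum_(p : 'S_b) u (p x) = 0.
Proof.
move=> u0.
have E (y : 'I_b) : \sum_(p : 'S_b) u (p x) = \sum_(p : 'S_b) u (p y).
  rewrite (reindex_inj (mulgI (tperm x y))) /=; apply: eq_bigr => p _.
  by rewrite permM tpermL.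
have : \sum_(y < b) \sum_(p : 'S_b) u (p x) = 0.
  rewrite (eq_bigr (fun y => \sum_(p : 'S_b) u (p y))) => [|y _]; last exact: E.
  rewrite exchange_big /= big1 // => p _.
  by rewrite -(reindex_inj (@perm_inj _ p) (P := xpredT) (F := u)).
rewrite sumr_const card_ord => /eqP; rewrite mulrn_eq0 => /orP[|/eqP //].
by rewrite eqn0Ngt (ltnW hb).
Qed.

Definition mul_at_key (q0 : keys) (p : 'S_b) (w : family) : family :=
  [ffun q => if q == q0 then (w q * p)%g else w q].

Lemma mul_at_key_inj q0 p : injective (mul_at_key q0 p).
Proof.
move=> w w' /ffunP E; apply/ffunP => q; have := E q; rewrite !ffunE.
by case: eqP => // _; apply: mulIg.
Qed.

(** Modifying the permutation at the key of digit i affects no later digit,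
    because the keys of the other digits have other lengths. *)
Lemma scramble_cells_mul_at_key j (i : 'I_N) (a : cells) p w :
  scramble_cells (mul_at_key (j, key i (a j)) p w) a =
  [ffun j' => if j' == j then set_digit (scramble_cells w a j) i (p (scramble_cells w a j i))
              else scramble_cells w a j'].
Proof.
apply/ffunP => j'; apply/ffunP => i'; rewrite !ffunE xpair_eqE.
case: (eqVneq j' j) => [->|_] //=; last by rewrite ffunE.
rewrite !ffunE; case: (eqVneq i' i) => [->|ii]; first by rewrite eqxx permM.
case: eqP => // /key_inj [||E _]; rewrite ?(ltnW (ltn_ord _)) //.
by case/eqP: ii; exact: val_inj.
Qed.

Lemma scramble_cells_mul_at_key_agree j (i : 'I_N) (a a' : cells) (k' : 'I_d -> nat) p w :
  (k' j <= i.+1)%N -> (k' j <= i)%N || ~~ agree i (a j) (a' j) ->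
  cells_agree k' (scramble_cells (mul_at_key (j, key i (a j)) p w) a') (scramble_cells w a').
Proof.
move=> ki kia; apply/cells_agreeP => j'; apply/agreeP => i' ik; rewrite !ffunE.
case: eqP => // -[jj /key_inj[||ii aa]]; rewrite ?(ltnW (ltn_ord _)) //.
move: kia; rewrite -ii agree_sym -[X in a' X]jj aa orbF leqNgt.
by rewrite -jj ik.
Qed.

(** Multiply the permutation that acts on the digit of index k j - 1 of a by an
    arbitrary p.  This preserves the uniform law of the family and, under the
    hypotheses, every digit of a' that the second factor reads, while the average
    over p of the first factor vanishes. *)
Lemma scrambled_components_orthogonal (H H' : cells -> R) (k k' : 'I_d -> nat) (a a' : cells) j :
  (0 < k j <= N)%N -> (k' j <= k j)%N ->
  (k' j < k j)%N || ~~ agree (k j).-1 (a j) (a' j) ->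
  \sum_w haar_component H k (scramble_cells w a) * haar_component H' k' (scramble_cells w a') = 0.
Proof.
move=> /andP[k0 kN] k'k kagree.
have iN : ((k j).-1 < N)%N by rewrite prednK.
pose i := Ordinal iN; pose q := (j, key i (a j)).
have ki : k j = i.+1 by rewrite /= prednK.
pose Z w := haar_component H k (scramble_cells w a) * haar_component H' k' (scramble_cells w a').
have Zp p : \sum_w Z w = \sum_w Z (mul_at_key q p w).
  by rewrite (reindex_inj (@mul_at_key_inj q p)).
have : \sum_(p : 'S_b) \sum_w Z w = 0.
  rewrite (eq_bigr (fun p => \sum_w Z (mul_at_key q p w))) => [|p _]; last exact: Zp.
  rewrite exchange_big big1 //= => w _.
  rewrite (eq_bigr (fun p => haar_component H k (scramble_cells (mul_at_key q p w) a) *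
                             haar_component H' k' (scramble_cells w a'))); last first.
    move=> p _; congr (_ * _); apply: haar_component_congr; apply: scramble_cells_mul_at_key_agree.
      by rewrite -ki.
    by move: kagree; rewrite ki.
  rewrite -mulr_suml [X in X * _](_ : _ = 0) ?mul0r //.
  rewrite exchange_big big1 //= => c _; rewrite -mulr_sumr.
  rewrite (eq_bigr (fun p : 'S_b =>
    haar_kernel R (k j) (set_digit (scramble_cells w a j) i (p (scramble_cells w a j i))) (c j) *
    \prod_(j' | j' != j) haar_kernel R (k j') (scramble_cells w a j') (c j'))); last first.
    move=> p _; rewrite (bigD1 j) //= scramble_cells_mul_at_key; congr (_ * _).
      by rewrite ffunE eqxx.
    by apply: eq_bigr => j' /negPf jj; rewrite ffunE jj.
  rewrite -mulr_suml [X in _ * (X * _)](_ : _ = 0) ?mul0r ?mulr0 //.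
  apply: (sum_perm0 (u := fun x =>
    haar_kernel R (k j) (set_digit (scramble_cells w a j) i x) (c j))).
  by rewrite ki sum_digit_haar_kernel.
rewrite sumr_const => /eqP; rewrite mulrn_eq0 => /orP[|/eqP //].
by rewrite eqn0Ngt; apply: contraNeq => _; apply/card_gt0P; exists 1%g.
Qed.

Lemma card_family_neq0 : (#|family|%:R : R) != 0.
Proof.
by rewrite pnatr_eq0 -lt0n; apply/card_gt0P; exists [ffun=> 1%g].
Qed.

Lemma scrambled_component_mean (H : cells -> R) (k : 'I_d -> nat) (a : cells) :
  (forall j, k j <= N)%N -> (exists j, 0 < k j)%N ->
  \sum_w haar_component H k (scramble_cells w a) = 0.
Proof.
move=> kN [j kj].
rewrite -[RHS](@scrambled_components_orthogonal H (fun=> 1) k (fun=> 0%N) a a j); last 3 first.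
- by rewrite kj kN.
- by [].
- by rewrite kj.
apply: eq_bigr => w _; rewrite haar_component0 // /cell_mean sumr_const.
by rewrite divff ?mulr1 // card_cells // !expf_neq0 // pnatr_eq0 -lt0n ltnW.
Qed.

(** Pairing with the constant function shows that every component except the
    constant one has mean zero over the permutations. *)
Lemma scrambled_cell_uniform (H : cells -> R) (a : cells) :
  \sum_w H (scramble_cells w a) = #|family|%:R * cell_mean H.
Proof.
under eq_bigr => w _ do rewrite -(haar_component_decomp hb H (scramble_cells w a)).
rewrite exchange_big /= (bigD1 [ffun=> ord0]) //= [X in _ + X]big1 ?addr0.
  rewrite (eq_bigr (fun=> cell_mean H)) ?sumr_const ?mulr_natl // => w _.
  rewrite -(haar_component0 _ (scramble_cells w a)); apply: eq_bigr => c _; congr (_ * _).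
  by apply: eq_bigr => j _; rewrite ffunE.
move=> k k0; apply: scrambled_component_mean => [j|]; first by rewrite -ltnS.
apply/existsP; apply: contraNT k0; rewrite negb_exists => /forallP E.
apply/eqP/ffunP => j; rewrite ffunE; apply: val_inj => /=.
by apply/eqP; have := E j; rewrite -eqn0Ngt.
Qed.

End Scrambling.

(** * Variance of a scrambled net on functions of finitely many digits *)

Section NetVariance.
Variables (R : realFieldType) (d b N lam t m : nat).
Hypothesis hb : (1 < b)%N.
Hypothesis hd : (0 < d)%N.
Hypothesis hlam : (0 < lam)%N.
Hypothesis htm : (t <= m <= N)%N.

Local Notation cells := {ffun 'I_d -> {ffun 'I_N -> 'I_b}}.
Local Notation levels := {ffun 'I_d -> 'I_N.+1}.
Local Notation family := {ffun 'I_d * N.-bseq 'I_b -> 'S_b}.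

Variable a : 'I_(lam * b ^ m) -> cells.
Hypothesis net : forall k : 'I_d -> nat,
  (\sum_j k j = m - t)%N -> forall c : cells,
  #|[pred i | cells_agree k (a i) c]| = (lam * b ^ t)%N.

Let n : R := (lam * b ^ m)%:R.
Let b0 : (b%:R : R) != 0.
Proof. by rewrite pnatr_eq0 -lt0n ltnW. Qed.
Let bp : (0 : R) < b%:R.
Proof. by rewrite ltr0n ltnW. Qed.
Let n0 : 0 < n.
Proof. by rewrite ltr0n muln_gt0 hlam expn_gt0 ltnW. Qed.

Lemma prod_avg_kernel (k : 'I_d -> nat) (y c : cells) :
  \prod_j avg_kernel R (k j) (y j) (c j) =
  b%:R ^+ (\sum_j k j) / (b%:R ^+ N) ^+ d * (cells_agree k y c)%:R.
Proof.
rewrite /avg_kernel !big_split /= prodrXr prodr_const card_ord exprVn; congr (_ * _).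
case: (boolP (cells_agree k y c)) => [/cells_agreeP H|].
  by apply: big1 => j _; rewrite H.
rewrite negb_forall => /existsP[j /negPf H].
by rewrite (bigD1 j) //= H mul0r.
Qed.

Lemma sum_prod_avg_kernel (k : 'I_d -> nat) (y : cells) : (forall j, k j <= N)%N ->
  \sum_(c : cells) \prod_j avg_kernel R (k j) (y j) (c j) = 1.
Proof.
move=> kN; rewrite -(bigA_distr_bigA (fun (j : 'I_d) (c : {ffun 'I_N -> 'I_b}) =>
  avg_kernel R (k j) (y j) c)).
by apply: big1 => j _; rewrite sum_avg_kernel.
Qed.

Lemma cell_mean_agree (k : 'I_d -> nat) (y : cells) : (forall j, k j <= N)%N ->
  cell_mean (fun c => (cells_agree k y c)%:R : R) = b%:R ^- (\sum_j k j).
Proof.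
move=> kN; have H : b%:R ^+ (\sum_j k j) / (b%:R ^+ N) ^+ d *
    \sum_(c : cells) (cells_agree k y c)%:R = 1 :> R.
  rewrite -[RHS](sum_prod_avg_kernel y kN) mulr_sumr; apply: eq_bigr => c _.
  by rewrite prod_avg_kernel.
rewrite /cell_mean card_cells //.
by apply: (mulfI (x := b%:R ^+ (\sum_j k j))); rewrite ?expf_neq0 // divff
  ?expf_neq0 // -[RHS]H; ring.
Qed.

Lemma sumr_pred (I : finType) (P : pred I) :
  #|[pred i | P i]|%:R = \sum_i (P i)%:R :> R.
Proof.
rewrite -sum1_card natr_sum big_mkcond; apply: eq_bigr => i _.
by rewrite inE; case: (P i).
Qed.

(** A function of k j digits is also a function of k' j >= k j digits.  Raising
    one coordinate of k brings the total to m - t, where all the cells contain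
    the same number of points. *)
Lemma net_exact (th : cells -> R) (k : 'I_d -> nat) :
  (forall j, k j <= N)%N -> (\sum_j k j <= m - t)%N ->
  (forall y c, cells_agree k y c -> th y = th c) ->
  \sum_i th (a i) = n * cell_mean th.
Proof.
move=> kN kmt thk.
pose j0 := Ordinal hd.
pose k' j := if j == j0 then (k j0 + (m - t - \sum_j k j))%N else k j.
have kk' j : (k j <= k' j)%N by rewrite /k'; case: eqP => [->|]//; rewrite leq_addr.
have sk' : (\sum_j k' j = m - t)%N.
  rewrite (bigD1 j0) //= /k' eqxx.
  rewrite (eq_bigr k) => [|j /negPf -> //].
  by move: kmt; rewrite (bigD1 j0) //=; lia.
have k'N j : (k' j <= N)%N.
  apply: (@leq_trans (\sum_j k' j)); last by rewrite sk'; lia.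
  by rewrite (bigD1 j) //= leq_addr.
have thk' y c : cells_agree k' y c -> th y = th c.
  move=> /cells_agreeP H; apply: thk; apply/cells_agreeP => j.
  exact: agree_le (kk' j) (H j).
transitivity (\sum_i \sum_(c : cells) th c * \prod_j avg_kernel R (k' j) (a i j) (c j)).
  apply: eq_bigr => i _; rewrite -[LHS]mulr1.
  rewrite -[X in _ * X = _](sum_prod_avg_kernel (a i) k'N) mulr_sumr.
  apply: eq_bigr => c _; rewrite prod_avg_kernel.
  have [yc|yc] := boolP (cells_agree k' (a i) c).
    by rewrite (thk' _ _ yc).
  by rewrite !mulr0.
rewrite exchange_big /= /cell_mean mulr_suml mulr_sumr.
apply: eq_bigr => c _; rewrite -mulr_sumr mulrCA; congr (_ * _).
under eq_bigr do rewrite prod_avg_kernel.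
rewrite -mulr_sumr -sumr_pred (net sk') sk' card_cells /n.
have /andP[tm mN] := htm.
rewrite !natrM !natrX (_ : b%:R ^+ m = b%:R ^+ t * b%:R ^+ (m - t)); first by ring.
by rewrite -exprD subnKC.
Qed.

Lemma exists_below (s : nat) (k : 'I_d -> nat) : (s <= \sum_j k j)%N ->
  exists k' : 'I_d -> nat, (forall j, k' j <= k j)%N /\ (\sum_j k' j = s)%N.
Proof.
move=> sk; have [r Er] : exists r, (\sum_j k j = s + r)%N.
  by exists (\sum_j k j - s)%N; rewrite subnKC.
elim: r k {sk} Er => [|r IH] k Er; first by exists k; rewrite Er addn0.
have [j kj] : exists j, (0 < k j)%N.
  apply/existsP; apply: contra_eqT Er; rewrite negb_exists => /forallP E.
  rewrite big1 ?addnS // => j _; apply/eqP; by have := E j; rewrite -eqn0Ngt.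
have [|k' [k'k sk']] := IH (fun j' => if j' == j then (k j).-1 else k j').
  move: Er; rewrite (bigD1 j) // [in X in _ -> X](bigD1 j) //= eqxx.
  rewrite [in X in _ -> X](eq_bigr k) => [|j' /negPf -> //]; lia.
exists k'; split => // j'; have := k'k j'; case: eqP => // ->.
by move/leq_trans; apply; exact: leq_pred.
Qed.

(** Coarsening k to total level m - t and then forgetting one digit per coordinate
    gives a larger cell, on whose indicator the net is exact and whose volume is
    at most b^(t + d - m). *)
Lemma net_count (k : 'I_d -> nat) (c : cells) : (forall j, k j <= N)%N ->
  (m - t < \sum_j k j)%N ->
  \sum_i (cells_agree (fun j => (k j).-1) c (a i))%:R <= (lam * b ^ (t + d))%:R :> R.
Proof.
move=> kN mtk; have [k' [k'k sk']] := exists_below (ltnW mtk).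
pose q j := (k' j).-1.
have qN j : (q j <= N)%N.
  by rewrite (leq_trans (leq_pred _)) // (leq_trans (k'k j)).
have sq : (\sum_j q j <= m - t)%N.
  by rewrite -sk'; apply: leq_sum => j _; exact: leq_pred.
have sq' : (m - t <= \sum_j q j + d)%N.
  rewrite -sk' -[X in (_ + X)%N]card_ord -sum1_card -big_split /=.
  by apply: leq_sum => j _; rewrite /q; case: (k' j) => // x; rewrite addn1.
apply: (@le_trans _ _ (\sum_i (cells_agree q c (a i))%:R)).
  apply: ler_sum => i _; rewrite ler_nat.
  have [/cells_agreeP H|_] := boolP (cells_agree _ c _); last exact: leq0n.
  rewrite (_ : cells_agree q c (a i)) //; apply/cells_agreeP => j; apply: agree_le (H j).
  by rewrite /q -!subn1 leq_sub2r.
rewrite (net_exact (th := fun y => (cells_agree q c y)%:R) qN sq); last first.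
  move=> y y' /cells_agreeP H; congr (nat_of_bool _)%:R.
  apply/cells_agreeP/cells_agreeP => H' j.
    by apply: agree_trans (H' j) (H j).
  by apply: agree_trans (H' j) _; rewrite agree_sym H.
rewrite cell_mean_agree // ler_pdivrMr ?exprn_gt0 // -natrX -natrM ler_nat.
rewrite -mulnA leq_mul2l -expnD; apply/orP; right.
by apply: leq_pexp2l; [exact: ltnW | lia].
Qed.

(** The points of a net lying in one cell of k leading digits are scrambled into
    one cell, and scrambling permutes the cells, so the net average equals the
    mean of the component over all cells, which is zero. *)
Lemma net_integrates_coarse (H : cells -> R) (k : levels) w :
  (\sum_j k j <= m - t)%N -> k != [ffun=> ord0] ->
  \sum_i haar_component H (fun j => k j) (scramble_cells w (a i)) = 0.
Proof.
move=> kmt k0.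
have kN j : (k j <= N)%N by rewrite -ltnS.
rewrite (net_exact (th := fun y => haar_component H (fun j => k j) (scramble_cells w y)) kN kmt).
  rewrite /cell_mean (sum_scramble_cells w (haar_component H (fun j => k j))).
  rewrite sum_haar_component //.
    by rewrite mul0r mulr0.
  apply/existsP; apply: contraNT k0; rewrite negb_exists => /forallP E.
  apply/eqP/ffunP => j; rewrite ffunE; apply: val_inj => /=.
  by apply/eqP; have := E j; rewrite -eqn0Ngt.
by move=> y c yc; apply: haar_component_congr; exact: scramble_cells_agree.
Qed.

Lemma net_error (H : cells -> R) w :
  n^-1 * \sum_i H (scramble_cells w (a i)) - cell_mean H =
  n^-1 * \sum_(k : levels | (m - t < \sum_j k j)%N)
    \sum_i haar_component H (fun j => k j) (scramble_cells w (a i)).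
Proof.
have -> : \sum_i H (scramble_cells w (a i)) =
    \sum_(k : levels) \sum_i haar_component H (fun j => k j) (scramble_cells w (a i)).
  by rewrite exchange_big /=; apply: eq_bigr => i _; rewrite haar_component_decomp.
rewrite (bigID (fun k : levels => (m - t < \sum_j k j)%N)) /= mulrDr.
rewrite -addrA [X in _ + X](_ : _ = 0) ?addr0 //.
rewrite (bigD1 [ffun=> ord0]) /=; last first.
  by rewrite big1 // => j _; rewrite ffunE.
rewrite [X in _ * (_ + X)]big1 ?addr0; last first.
  by move=> k /andP[]; rewrite -leqNgt; exact: net_integrates_coarse.
rewrite (eq_bigr (fun=> cell_mean H)) => [|i _]; last first.
  rewrite -(haar_component0 _ (scramble_cells w (a i))); apply: eq_bigr => c _; congr (_ * _).
  by apply: eq_bigr => j _; rewrite ffunE.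
by rewrite sumr_const card_ord -mulr_natl mulKf ?subrr // gt_eqF.
Qed.

Variables (H : cells -> R) (beta : R).
Hypothesis Hbeta : forall (k : levels) y,
  `|haar_component H (fun j => k j) y| <= beta / b%:R ^+ (\sum_j k j).

Let beta0 : 0 <= beta.
Proof.
have := le_trans (normr_ge0 _) (Hbeta [ffun=> ord0]
  [ffun=> [ffun=> Ordinal (ltnW hb)]]).
by rewrite pmulr_lge0 // invr_gt0 exprn_gt0.
Qed.

Lemma net_covariance (k k' : levels) i i' : (m - t < \sum_j k j)%N ->
  \sum_w haar_component H (fun j => k j) (scramble_cells w (a i)) *
         haar_component H (fun j => k' j) (scramble_cells w (a i')) <=
  (k == k')%:R * (cells_agree (fun j => (k j).-1) (a i) (a i'))%:R *
    (#|family|%:R * (beta / b%:R ^+ (m - t)) ^+ 2).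
Proof.
move=> mtk.
have kN (k0 : levels) j : (k0 j <= N)%N by rewrite -ltnS.
have [kk|kk] := eqVneq k k'; last first.
  rewrite !mul0r le_eqVlt; apply/orP; left; apply/eqP.
  have [j kj] : exists j, k j != k' j.
    apply/existsP; apply: contraNT kk; rewrite negb_exists => /forallP E.
    by apply/eqP/ffunP => j; apply/eqP; have := E j; rewrite negbK.
  have : (k' j < k j)%N || (k j < k' j)%N by rewrite orbC -neq_ltn.
  case/orP => kj'.
    apply: (@scrambled_components_orthogonal _ _ _ _ hb _ _ _ _ _ _ j); rewrite ?kj' ?(ltnW kj') //.
    by rewrite kN (leq_ltn_trans _ kj').
  under eq_bigr do rewrite mulrC.
  apply: (@scrambled_components_orthogonal _ _ _ _ hb _ _ _ _ _ _ j); rewrite ?kj' ?(ltnW kj') //.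
  by rewrite kN (leq_ltn_trans _ kj').
rewrite mul1r -kk.
case: (boolP (cells_agree _ _ _)) => [_|]; last first.
  rewrite negb_forall => /existsP[j kj].
  rewrite !mul0r le_eqVlt; apply/orP; left; apply/eqP.
  apply: (@scrambled_components_orthogonal _ _ _ _ hb _ _ _ _ _ _ j) => //; last by rewrite kj orbT.
  by rewrite kN andbT lt0n; apply: contra kj => /eqP ->; exact: agree0.
rewrite mul1r mulr_natl -sumr_const; apply: ler_sum => w _.
rewrite (le_trans (ler_norm _)) // normrM expr2.
have B i0 : `|haar_component H (fun j => k j) (scramble_cells w (a i0))| <= beta / b%:R ^+ (m - t).
  rewrite (le_trans (Hbeta _ _)) // ler_wpM2l // lef_pV2 ?posrE ?exprn_gt0 //.
  by rewrite ler_eXn2l ?ltr1n // ltnW.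
by apply: ler_pM => //; rewrite normr_ge0.
Qed.

(** The covariances leave only the diagonal k = k' and at most lam b^(t + d)
    partners for each point.  The components are merely counted, by (N + 1)^d,
    and each is bounded by its value at the coarsest surviving level. *)
Lemma net_variance :
  \sum_w (n^-1 * \sum_i H (scramble_cells w (a i)) - cell_mean H) ^+ 2 <=
  #|family|%:R * (N.+1%:R ^+ d * (lam * b ^ (t + d))%:R / n *
    (beta / b%:R ^+ (m - t)) ^+ 2).
Proof.
pose Pk (k : levels) := (m - t < \sum_j k j)%N.
pose h (k : levels) w i := haar_component H (fun j => k j) (scramble_cells w (a i)).
have -> : \sum_w (n^-1 * \sum_i H (scramble_cells w (a i)) - cell_mean H) ^+ 2 =
  n ^- 2 * \sum_(k | Pk k) \sum_(k' | Pk k') \sum_i \sum_i'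
    \sum_w h k w i * h k' w i'.
  rewrite (eq_bigr (fun w => n ^- 2 * \sum_(k | Pk k) \sum_(k' | Pk k')
    \sum_i \sum_i' h k w i * h k' w i')); last first.
    move=> w _; rewrite net_error exprMn exprVn; congr (_ * _).
    rewrite expr2 mulr_suml; apply: eq_bigr => k _.
    rewrite mulr_sumr; apply: eq_bigr => k' _.
    rewrite mulr_suml; apply: eq_bigr => i _.
    by rewrite mulr_sumr.
  rewrite -mulr_sumr; congr (_ * _).
  rewrite exchange_big; apply: eq_bigr => k _ /=.
  rewrite exchange_big; apply: eq_bigr => k' _ /=.
  rewrite exchange_big; apply: eq_bigr => i _ /=.
  by rewrite exchange_big.
set V := #|family|%:R * (beta / b%:R ^+ (m - t)) ^+ 2.
have V0 : 0 <= V by rewrite mulr_ge0 // sqr_ge0.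
apply: (@le_trans _ _ (n ^- 2 * \sum_(k | Pk k) (n * ((lam * b ^ (t + d))%:R * V)))).
  rewrite ler_wpM2l ?invr_ge0 ?sqr_ge0 //; apply: ler_sum => k Pkk.
  apply: (@le_trans _ _ (\sum_(k' | Pk k') (k == k')%:R *
      \sum_i (\sum_i' (cells_agree (fun j => (k j).-1) (a i) (a i'))%:R) * V)).
    apply: ler_sum => k' _; rewrite mulr_sumr; apply: ler_sum => i _.
    rewrite mulr_suml mulr_sumr; apply: ler_sum => i' _.
    by rewrite mulrA; exact: net_covariance.
  rewrite (bigD1 k) //= eqxx mul1r [X in _ + X]big1 ?addr0; last first.
    by move=> k' /andP[_ /negPf]; rewrite eq_sym => ->; rewrite mul0r.
  rewrite /n mulr_natl -[X in _ *+ X](card_ord (lam * b ^ m)) -sumr_const.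
  apply: ler_sum => i _; rewrite ler_wpM2r //; apply: net_count => // j.
  by rewrite -ltnS.
apply: (@le_trans _ _ (n ^- 2 * (N.+1%:R ^+ d * (n * ((lam * b ^ (t + d))%:R * V))))).
  rewrite ler_wpM2l ?invr_ge0 ?sqr_ge0 // sumr_const -[leLHS]mulr_natl ler_wpM2r //.
    by rewrite mulr_ge0 ?(ltW n0) // mulr_ge0.
  rewrite -natrX ler_nat (leq_trans (max_card _)) //.
  by rewrite card_ffun !card_ord.
rewrite le_eqVlt; apply/orP; left; apply/eqP; rewrite /V.
have nn : n != 0 by rewrite gt_eqF.
by move: n nn => n1 nn; field; rewrite nn expf_neq0.
Qed.

End NetVariance.

(** * Mixed differences and the mean value theorem *)

Section Calculus.
Variables (R : realType) (d : nat).
Implicit Types (f g : 'rV[R]_d -> R) (t x : 'rV[R]_d) (j : 'I_d).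

Local Notation dir j := (delta_mx 0 j : 'rV[R]_d).

Definition update_coord (j : 'I_d) (r : R) (t : 'rV[R]_d) : 'rV[R]_d :=
  \row_i (if i == j then r else t 0 i).

Lemma update_coord_shift j h r t : update_coord j (h + r) t = h *: dir j + update_coord j r t.
Proof.
apply/rowP => i; rewrite !mxE eqxx /=; case: eqP => _; first by rewrite mulr1.
by rewrite mulr0 add0r.
Qed.

Lemma update_coordC i j r s t : i != j ->
  update_coord i r (update_coord j s t) = update_coord j s (update_coord i r t).
Proof.
move=> ij; apply/rowP => k; rewrite !mxE.
by case: (eqVneq k i) => [->|_] //; rewrite (negPf ij).
Qed.

Lemma update_coord_id j t : update_coord j (t 0 j) t = t.
Proof. by apply/rowP => i; rewrite mxE; case: eqP => [->|]. Qed.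

(** The directional derivative is a derivative in one real variable, so that the
    mean value theorem applies. *)
Lemma is_derive_update f j t (r : R) : derivable f (update_coord j r t) (dir j) ->
  is_derive r 1 (fun s => f (update_coord j s t)) (partial j f (update_coord j r t)).
Proof.
move=> df.
have E : (fun h : R => h^-1 *: (((fun s => f (update_coord j s t)) \o shift r) (h *: 1)
    - f (update_coord j r t))) =
  (fun h : R => h^-1 *: ((f \o shift (update_coord j r t)) (h *: dir j) - f (update_coord j r t))).
  by apply/funext => h /=; rewrite [h *: 1]mulr1 update_coord_shift.
by split; rewrite /derivable /partial /derive E.
Qed.

Lemma is_derive_of_update f j x (df : R) :
  is_derive (x 0 j) 1 (fun s => f (update_coord j s x)) df -> is_derive x (dir j) f df.
Proof.
have E : (fun h : R => h^-1 *: (((fun s => f (update_coord j s x)) \o shift (x 0 j)) (h *: 1)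
    - f (update_coord j (x 0 j) x))) =
  (fun h : R => h^-1 *: ((f \o shift x) (h *: dir j) - f x)).
  by apply/funext => h /=; rewrite [h *: 1]mulr1 update_coord_shift update_coord_id.
by move=> [H <-]; split; [move: H|]; rewrite /derivable /derive E.
Qed.

Lemma is_derive_bigsum (I : Type) (s : seq I) (V : normedModType R)
    (F : I -> V -> R) (dF : I -> R) (x v : V) :
  (forall i, is_derive x v (F i) (dF i)) ->
  is_derive x v (fun y => \sum_(i <- s) F i y) (\sum_(i <- s) dF i).
Proof.
move=> dFi; elim: s => [|i s IH].
  rewrite big_nil (_ : (fun y => _) = cst 0); first exact: is_derive_cst.
  by apply/funext => y; rewrite big_nil.
rewrite big_cons (_ : (fun y => _) = F i + (fun y => \sum_(i <- s) F i y)).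
  exact: is_deriveD.
by apply/funext => y; rewrite big_cons.
Qed.

Lemma lipschitz_derive (g dg : R -> R) (C u v : R) :
  (forall r : R, is_derive r 1 g (dg r)) -> (forall r, `|dg r| <= C) ->
  `|g u - g v| <= C * `|u - v|.
Proof.
move=> gd gC.
wlog vu : u v / v <= u => [H|].
  have [/H //|/ltW/H] := leP v u; by rewrite distrC (distrC v).
have [|c _ ->] := @MVT_segment R g dg v u vu (fun r _ => gd r).
  by apply: derivable_within_continuous => x _; apply: ex_derive.
by rewrite normrM ler_wpM2r.
Qed.

Section NestedSum.
Variables (X : finType) (nu : 'I_d -> X -> R) (pt : 'I_d -> X -> R).

(** The effect on f of the tensor product over s of the signed measures with
    masses nu j c at the points pt j c, the other coordinates being those of t.
    The nested form, unlike a sum over tuples, allows differentiating under all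
    the inner sums at once. *)
Fixpoint nested_sum (s : seq 'I_d) f t : R :=
  if s is j :: s' then \sum_c nu j c * nested_sum s' f (update_coord j (pt j c) t) else f t.

Lemma is_derive_nested_sum s f j t (r : R) : j \notin s ->
  (forall x, derivable f x (dir j)) ->
  is_derive r 1 (fun u => nested_sum s f (update_coord j u t))
    (nested_sum s (partial j f) (update_coord j r t)).
Proof.
move=> + df; elim: s t => [|i s IH] t /=; first by move=> _; exact: is_derive_update.
rewrite inE negb_or => /andP[ji js]; apply: is_derive_bigsum => c.
rewrite (_ : (fun u => _) = nu i c \*:
    (fun u => nested_sum s f (update_coord j u (update_coord i (pt i c) t)))).
  rewrite update_coordC 1?eq_sym //; exact: is_deriveZ (IH _ js).
by apply/funext => u; rewrite update_coordC // eq_sym.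
Qed.

Variables (f0 : 'rV[R]_d -> R) (K0 : R).
Hypothesis f0_der : forall j s, subseq (j :: s) (enum 'I_d) ->
  forall x, derivable (foldr (@partial R d) f0 s) x (dir j).
Hypothesis f0_bound : forall s, subseq s (enum 'I_d) ->
  forall x, `|foldr (@partial R d) f0 s x| <= K0.

Variables (z : pred 'I_d) (w : 'I_d -> R) (p0 : 'I_d -> R).
Hypothesis nu1 : forall j, ~~ z j -> \sum_c `|nu j c| <= 1.
Hypothesis nu2 : forall j, z j -> \sum_c `|nu j c| <= 2.
Hypothesis nu0 : forall j, z j -> \sum_c nu j c = 0.
Hypothesis nuw : forall j c, z j -> nu j c != 0 -> `|pt j c - p0 j| <= w j.
Hypothesis w0 : forall j, 0 <= w j.

Let K00 : 0 <= K0.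
Proof. exact: le_trans (normr_ge0 _) (f0_bound (sub0seq _) 0). Qed.

(** Let j be the coordinate of the outermost sum.  As nu j has total mass zero,
    only increments in coordinate j contribute, and by the mean value theorem
    they are bounded by the inner sums of the derivative of f along j.  The
    coordinates are removed from the last to the first: each new derivative is
    then taken outside the previous ones, exactly as mixed partial derivatives
    are nested, so that derivatives never have to be exchanged. *)
Lemma nested_sum_bound s e2 u t : rev s ++ e2 = enum 'I_d -> subseq u e2 ->
  `|nested_sum s (foldr (@partial R d) f0 u) t| <=
    K0 * \prod_(j <- s) (if z j then 2 * w j else 1).
Proof.
elim: s e2 u t => [|j s IH] e2 u t /=.
  by move=> ee ue; rewrite big_nil mulr1; apply: f0_bound; rewrite -ee.
rewrite rev_cons cat_rcons big_cons => E ue.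
have js : subseq (j :: u) (j :: e2) by rewrite /= eqxx.
have us : subseq u (j :: e2) by apply: subseq_trans ue _; exact: subseq_cons.
have jns : j \notin s.
  have := enum_uniq 'I_d; rewrite -E cat_uniq => /and3P[_ + _].
  by rewrite /= negb_or mem_rev => /andP[].
have je : subseq (j :: u) (enum 'I_d).
  by rewrite -E; apply: subseq_trans js _; exact: suffix_subseq.
set Q := \prod_(i <- s) _.
have Q0 : 0 <= Q.
  by apply: prodr_ge0 => i _; case: ifP => // _; rewrite mulr_ge0.
case: ifPn => zj.
  pose G v := nested_sum s (foldr (@partial R d) f0 u) (update_coord j v t).
  have GL v : `|G v - G (p0 j)| <= K0 * Q * `|v - p0 j|.
    apply: (@lipschitz_derive _ (fun v =>
        nested_sum s (partial j (foldr (@partial R d) f0 u)) (update_coord j v t))) => v'.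
      exact: is_derive_nested_sum (f0_der je).
    exact: (IH (j :: e2) (j :: u)).
  have -> : \sum_c nu j c * G (pt j c) = \sum_c nu j c * (G (pt j c) - G (p0 j)).
    under [RHS]eq_bigr do rewrite mulrBr.
    by rewrite sumrB -mulr_suml nu0 // mul0r subr0.
  apply: (@le_trans _ _ (\sum_c `|nu j c| * (K0 * Q * w j))).
    rewrite (le_trans (ler_norm_sum _ _ _)) //; apply: ler_sum => c _.
    rewrite normrM; have [->|nc] := eqVneq (nu j c) 0; first by rewrite normr0 !mul0r.
    rewrite ler_wpM2l // (le_trans (GL _)) // ler_wpM2l ?mulr_ge0 //.
    exact: nuw.
  rewrite -mulr_suml (_ : K0 * (_ * _) = 2 * (K0 * Q * w j)); last by ring.
  by rewrite ler_wpM2r ?nu2 // !mulr_ge0.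
apply: (@le_trans _ _ (\sum_c `|nu j c| * (K0 * Q))).
  rewrite (le_trans (ler_norm_sum _ _ _)) //; apply: ler_sum => c _.
  rewrite normrM ler_wpM2l //; exact: (IH (j :: e2)).
by rewrite -mulr_suml mul1r -[leRHS]mul1r ler_wpM2r ?nu1 // mulr_ge0.
Qed.

Local Notation points c := (\row_i pt i ((c : {ffun 'I_d -> X}) i) : 'rV[R]_d).

Lemma nested_sumE s f (c0 : {ffun 'I_d -> X}) : uniq s ->
  nested_sum s f (points c0) =
  \sum_(c : {ffun 'I_d -> X} | [forall i, (i \notin s) ==> (c i == c0 i)])
    f (points c) * \prod_(j <- s) nu j (c j).
Proof.
elim: s c0 => [|j s IH] c0 /=.
  move=> _; rewrite (big_pred1 c0) ?big_nil ?mulr1 // => c /=.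
  apply/forallP/eqP => [H|-> i]; last by rewrite eqxx ?implybT.
  by apply/ffunP => i; apply/eqP; have := H i.
move=> /andP[js us].
rewrite [RHS](partition_big (fun c : {ffun 'I_d -> X} => c j) xpredT) //=.
apply: eq_bigr => a _.
have -> : update_coord j (pt j a) (points c0) =
    points [ffun i => if i == j then a else c0 i].
  by apply/rowP => i; rewrite !mxE ffunE; case: eqP => [->|].
rewrite IH // mulr_sumr; apply: eq_big => [c|c].
  apply/forallP/andP => [H|[/forallP H /eqP cj] i].
    have cj : c j == a by have := implyP (H j) js; rewrite ffunE eqxx.
    split=> //; apply/forallP => i; rewrite inE negb_or; apply/implyP => /andP[ij iS].
    by have := implyP (H i) iS; rewrite ffunE (negPf ij).
  apply/implyP => iS; rewrite ffunE; case: (eqVneq i j) => [->|ij]; first by rewrite cj.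
  by apply: (implyP (H i)); rewrite inE negb_or ij.
move=> /forallP H; rewrite big_cons.
have := implyP (H j) js; rewrite ffunE eqxx => /eqP ->; ring.
Qed.

(** The discrete form of the estimate of a mixed difference by the integral of a
    mixed derivative: each coordinate with a signed weight of total mass zero
    gains the diameter of the support of that weight. *)
Lemma tensor_bound :
  `|\sum_(c : {ffun 'I_d -> X}) f0 (points c) * \prod_j nu j (c j)| <=
    K0 * \prod_j (if z j then 2 * w j else 1).
Proof.
have [c0 _|E] := pickP (xpredT : pred {ffun 'I_d -> X}); last first.
  rewrite [\sum_c _]big_pred0 ?normr0 => [|c]; last by have := E c.
  rewrite mulr_ge0 ?prodr_ge0 // => j _; case: ifP => // _; exact: mulr_ge0.
have := @nested_sum_bound (rev (enum 'I_d)) [::] [::] (points c0).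
rewrite revK cats0 => /(_ erefl isT) /=.
rewrite nested_sumE ?rev_uniq ?enum_uniq // => H.
have -> : \prod_j (if z j then 2 * w j else 1) =
    \prod_(j <- rev (enum 'I_d)) (if z j then 2 * w j else 1).
  by rewrite -[LHS]big_enum; apply/esym/perm_big; rewrite perm_rev.
apply: le_trans H; rewrite le_eqVlt; apply/orP; left; apply/eqP.
congr (`| _ |); apply: eq_big => [c|c _].
  by apply/esym/forallP => i; rewrite mem_rev mem_enum.
by congr (_ * _); rewrite -[LHS]big_enum; apply/esym/perm_big; rewrite perm_rev.
Qed.

End NestedSum.

Lemma lipschitz_partials f (K0 : R) x y :
  (forall j x, derivable f x (dir j)) -> (forall j x, `|partial j f x| <= K0) ->
  `|f y - f x| <= K0 * \sum_j `|y 0 j - x 0 j|.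
Proof.
move=> fd fK.
pose mixs (s : seq 'I_d) := \row_i (if i \in s then y 0 i else x 0 i) : 'rV[R]_d.
have H (s : seq 'I_d) : uniq s ->
    `|f (mixs s) - f x| <= K0 * \sum_(j <- s) `|y 0 j - x 0 j|.
  elim: s => [|j s IH].
    move=> _; rewrite big_nil mulr0 (_ : mixs [::] = x) ?subrr ?normr0 //.
    by apply/rowP => i; rewrite mxE.
  move=> /andP[js us]; rewrite big_cons mulrDr.
  have -> : mixs (j :: s) = update_coord j (y 0 j) (mixs s).
    by apply/rowP => i; rewrite !mxE inE; case: eqP => [->|].
  have E : mixs s = update_coord j (x 0 j) (mixs s).
    by apply/rowP => i; rewrite !mxE; case: eqP => [->|] //; rewrite (negPf js).
  apply: (le_trans (ler_distD (f (mixs s)) _ _)); apply: lerD (IH us).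
  rewrite [in X in _ - X]E.
  apply: (@lipschitz_derive (fun r => f (update_coord j r (mixs s)))
    (fun r => partial j f (update_coord j r (mixs s)))) => // r.
  exact: is_derive_update.
have := H (enum 'I_d) (enum_uniq _); rewrite big_enum.
rewrite (_ : mixs _ = y) //; apply/rowP => i; by rewrite mxE mem_enum.
Qed.

End Calculus.

(** * Derivatives of a Gaussian times a function of slower growth *)

Section GaussianProduct.
Variables (R : realType) (d : nat).
Implicit Types (t x : 'rV[R]_d) (j : 'I_d).

Local Notation dir j := (delta_mx 0 j : 'rV[R]_d).

Lemma enorm_sqr x : enorm x ^+ 2 = \sum_j x 0 j ^+ 2.
Proof. by rewrite sqr_sqrtr // sumr_ge0 // => j _; rewrite sqr_ge0. Qed.

Lemma is_derive_phi x j : is_derive x (dir j) (@phi R d) (- x 0 j * phi x).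
Proof.
apply: is_derive_of_update.
pose c := (2 * pi) `^ (- (d%:R / 2)) : R.
pose S := \sum_(i | i != j) x 0 i ^+ 2.
have E : (fun s : R => phi (update_coord j s x)) =
    (fun s => c *: expR (- ((s ^+ 2 + S) / 2))).
  apply/funext => s; rewrite /phi enorm_sqr (bigD1 j) //= mxE eqxx.
  congr (_ * expR (- ((_ + _) / 2))); apply: eq_bigr => i /negPf ij.
  by rewrite mxE ij.
rewrite E; set a := x 0 j.
have -> : - a * phi x = c *: (- (a + a) / 2 * expR (- ((a ^+ 2 + S) / 2))).
  have -> : phi x = c * expR (- ((a ^+ 2 + S) / 2)).
    by rewrite /phi enorm_sqr (bigD1 j).
  by rewrite [RHS]mulrA /GRing.scale /=; field.
apply: is_deriveZ; rewrite mulrC.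
apply: (@is_derive1_comp _ expR (fun s => - ((s ^+ 2 + S) / 2)) a).
rewrite (_ : (fun s => _) = (fun s => (- 2^-1) *: (s ^+ 2 + S))); last first.
  by apply/funext => s; rewrite /GRing.scale /=; ring.
rewrite (_ : - (a + a) / 2 = (- 2^-1) *: (a + a + 0)); last first.
  by rewrite /GRing.scale /=; ring.
have D : is_derive a (1 : R) (fun s : R => s ^+ 2) (a + a).
  rewrite (_ : (fun s : R => _) = (@id R) * (@id R)); last first.
    by apply/funext => s; rewrite expr2.
  apply: (is_derive_eq (is_deriveM (is_derive_id a (1 : R)) (is_derive_id a (1 : R)))).
  by rewrite /GRing.scale /= mulr1.
exact: is_deriveZ (is_deriveD D (is_derive_cst S a 1)).
Qed.

(** The operator prod_(j in s) (d_j - x_j) applied to q, when Q l is the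
    derivative of q along l.  Since d_j phi = - x_j phi, the mixed derivative
    of phi q along s is phi times this function. *)
Fixpoint weighted_deriv (s : seq 'I_d) (Q : seq 'I_d -> 'rV[R]_d -> R) (x : 'rV[R]_d) : R :=
  if s is j :: s' then weighted_deriv s' (fun l => Q (j :: l)) x - x 0 j * weighted_deriv s' Q x
  else Q [::] x.

Lemma is_derive_coord x i j : i != j -> is_derive x (dir j) (fun y : 'rV[R]_d => y 0 i) 0.
Proof.
move=> ij; apply: is_derive_of_update.
rewrite (_ : (fun s => _) = cst (x 0 i)); first exact: is_derive_cst.
by apply/funext => s; rewrite mxE (negPf ij).
Qed.

Lemma is_derive_weighted_deriv s (Q : seq 'I_d -> 'rV[R]_d -> R) x j : j \notin s ->
  (forall l, subseq l s -> derivable (Q l) x (dir j)) ->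
  is_derive x (dir j) (weighted_deriv s Q) (weighted_deriv s (fun l => partial j (Q l)) x).
Proof.
elim: s Q => [|i s IH] Q /=.
  by move=> _ /(_ [::] isT) H; split => //.
rewrite inE negb_or => /andP[ji js] H.
have D0 : is_derive x (dir j) (weighted_deriv s (fun l => Q (i :: l)))
    (weighted_deriv s (fun l => partial j (Q (i :: l))) x).
  by apply: IH => // l ls; apply: H; rewrite eqxx.
have D1 : is_derive x (dir j) (weighted_deriv s Q) (weighted_deriv s (fun l => partial j (Q l)) x).
  apply: IH => // l ls; apply: H; exact: subseq_trans ls (subseq_cons _ _).
have D2 : is_derive x (dir j) (fun y : 'rV[R]_d => y 0 i) 0.
  by apply: is_derive_coord; rewrite eq_sym.
apply: (is_derive_eq (is_deriveB D0 (is_deriveM D2 D1))).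
by rewrite /GRing.scale /= mulr0 addr0.
Qed.

Lemma weighted_deriv_bound s (Q : seq 'I_d -> 'rV[R]_d -> R) x (b : R) :
  (forall l, subseq l s -> `|Q l x| <= b) ->
  `|weighted_deriv s Q x| <= b * \prod_(j <- s) (1 + `|x 0 j|).
Proof.
elim: s Q => [|i s IH] Q H /=; first by rewrite big_nil mulr1; exact: H.
rewrite big_cons (le_trans (ler_normB _ _)) //.
have H1 := IH (fun l => Q (i :: l)).
have H2 := IH Q.
rewrite normrM mulrCA mulrDl mul1r; apply: lerD.
  by apply: H1 => l ls; apply: H; rewrite /= eqxx.
rewrite ler_wpM2l //; apply: H2 => l ls; apply: H.
exact: subseq_trans ls (subseq_cons _ _).
Qed.

Variables (M B : R) (q : 'rV[R]_d -> R).
Hypothesis hM : 0 < M < 1 / 2.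
Hypothesis hq : Ge2 M B q.

(** An increasing list of coordinates is the enumeration of the set of its
    elements. *)
Lemma mixed_partial_seq s : subseq s (enum 'I_d) ->
  foldr (@partial R d) q s = mixed_partial [set j in s] q.
Proof.
move=> /(subseq_uniqP (enum_uniq _)) E.
rewrite /mixed_partial; congr foldr; rewrite {1}E enumT.
by apply/esym/eq_filter => j; rewrite !inE.
Qed.

Lemma growth_mixed_bound s x : subseq s (enum 'I_d) ->
  `|foldr (@partial R d) q s x| <= B * expR (M * enorm x ^+ 2).
Proof. by move=> sE; rewrite mixed_partial_seq //; exact: hq.2. Qed.

Lemma growth_derivable j s x : subseq s (enum 'I_d) -> j \notin s ->
  derivable (foldr (@partial R d) q s) x (dir j).
Proof.
move=> sE js; rewrite mixed_partial_seq //.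
by apply: (hq.1 _).2; rewrite inE.
Qed.

Let f x := phi x * q x.

Lemma phi_ge0 x : 0 <= phi x.
Proof. by rewrite mulr_ge0 ?powR_ge0 ?expR_ge0. Qed.

Lemma gauss_mul_mixed s : subseq s (enum 'I_d) ->
  foldr (@partial R d) f s =
    (fun x => phi x * weighted_deriv s (fun l => foldr (@partial R d) q l) x) /\
  (forall j x, j \notin s -> derivable (foldr (@partial R d) f s) x (dir j)).
Proof.
have D s' j x : subseq s' (enum 'I_d) -> j \notin s' ->
    is_derive x (dir j)
      (@phi R d * weighted_deriv s' (fun l => foldr (@partial R d) q l))
      (phi x * weighted_deriv (j :: s') (fun l => foldr (@partial R d) q l) x).
  move=> sE js.
  have D1 := is_derive_phi x j.
  have D2 : is_derive x (dir j) (weighted_deriv s' (fun l => foldr (@partial R d) q l))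
      (weighted_deriv s' (fun l => foldr (@partial R d) q (j :: l)) x).
    apply: is_derive_weighted_deriv => // l ls; apply: growth_derivable.
      exact: subseq_trans ls sE.
    by apply: contra js; exact: (mem_subseq ls).
  apply: (is_derive_eq (is_deriveM D1 D2)).
  by rewrite /GRing.scale /=; ring.
elim: s => [|j s IH] sE.
  split=> // j x js; have [] := D [::] j x sE js.
  by [].
have sE' : subseq s (enum 'I_d) by apply: subseq_trans sE; exact: subseq_cons.
have js : j \notin s.
  by have := subseq_uniq sE (enum_uniq _) => /= /andP[].
have [E _] := IH sE'.
have E' : foldr (@partial R d) f (j :: s) =
    (fun x => phi x * weighted_deriv (j :: s) (fun l => foldr (@partial R d) q l) x).
  apply/funext => x /=; rewrite /partial E.
  by have [_ ->] := D s j x sE' js.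
split=> // i x ijs; rewrite E'.
by have [+ _] := D (j :: s) i x sE ijs.
Qed.

Definition gauss_const : R := (2 * pi) `^ (- (d%:R / 2)).

Lemma gauss_const_ge0 : 0 <= gauss_const.
Proof. exact: powR_ge0. Qed.

Lemma growth_const_ge0 : 0 <= B.
Proof.
have := le_trans (normr_ge0 _) (growth_mixed_bound 0 (sub0seq _)).
by rewrite pmulr_lge0 // expR_gt0.
Qed.

Lemma gauss_mul_bound x :
  `|f x| <= gauss_const * B * expR (- ((1 / 2 - M) * enorm x ^+ 2)).
Proof.
rewrite /f normrM (ger0_norm (phi_ge0 _)) /phi -/gauss_const.
rewrite -[leLHS]mulrA -[leRHS]mulrA ler_wpM2l ?gauss_const_ge0 //.
have := growth_mixed_bound x (sub0seq _) => /=.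
move=> /(ler_wpM2l (expR_ge0 (- (enorm x ^+ 2 / 2)))) /le_trans; apply.
rewrite mulrCA -expRD ler_wpM2l ?growth_const_ge0 // ler_expR.
by rewrite le_eqVlt; apply/orP; left; apply/eqP; ring.
Qed.

Let alpha := 1 / 2 - M.
Let alpha0 : 0 < alpha.
Proof. by case/andP: hM => _ M2; rewrite /alpha subr_gt0. Qed.

Definition deriv_const : R := 2 + alpha^-1.

Lemma deriv_const_ge1 : 1 <= deriv_const.
Proof.
have : 0 < alpha^-1 by rewrite invr_gt0.
rewrite /deriv_const; lra.
Qed.

(** From exp(u) >= 1 + u with u = alpha r^2 and |r| <= 1 + r^2. *)
Lemma linear_le_gauss (r : R) : (1 + `|r|) * expR (- (alpha * r ^+ 2)) <= deriv_const.
Proof.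
have E : 1 + alpha * r ^+ 2 <= expR (alpha * r ^+ 2) by exact: expR_ge1Dx.
rewrite expRN ler_pdivrMr ?expR_gt0 //.
apply: (@le_trans _ _ (deriv_const * (1 + alpha * r ^+ 2))); last first.
  by rewrite ler_wpM2l // (le_trans ler01 deriv_const_ge1).
have -> : deriv_const * (1 + alpha * r ^+ 2) =
    2 + 2 * (alpha * r ^+ 2) + alpha^-1 + r ^+ 2.
  by rewrite /deriv_const; field; rewrite gt_eqF.
have a1 : 0 < alpha^-1 by rewrite invr_gt0.
have a2 : 0 <= alpha * r ^+ 2 by rewrite mulr_ge0 ?sqr_ge0 ?ltW.
have : `|r| <= 1 + r ^+ 2.
  rewrite -real_normK ?num_real //.
  have := sqr_ge0 (`|r| - 1); have := normr_ge0 r; nra.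
lra.
Qed.

(** Every coordinate of s costs a factor 1 + |x_j|, absorbed by its own factor
    exp(-(1/2 - M) x_j^2). *)
Lemma gauss_mul_mixed_bound s x : subseq s (enum 'I_d) ->
  `|foldr (@partial R d) f s x| <= gauss_const * B * deriv_const ^+ d.
Proof.
move=> sE; have [-> _] := gauss_mul_mixed sE.
have hb := @weighted_deriv_bound s (fun l => foldr (@partial R d) q l) x
  (B * expR (M * enorm x ^+ 2)).
rewrite normrM (ger0_norm (phi_ge0 _)) /phi -/gauss_const.
rewrite -[leLHS]mulrA -[leRHS]mulrA ler_wpM2l ?gauss_const_ge0 //.
apply: (@le_trans _ _ (expR (- (enorm x ^+ 2 / 2)) * (B * expR (M * enorm x ^+ 2) *
    \prod_(j <- s) (1 + `|x 0 j|)))).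
  rewrite ler_wpM2l ?expR_ge0 //; apply: hb => l ls.
  by apply: growth_mixed_bound; exact: subseq_trans ls sE.
rewrite -mulrA mulrCA ler_wpM2l ?growth_const_ge0 // mulrA -expRD.
have -> : - (enorm x ^+ 2 / 2) + M * enorm x ^+ 2 = \sum_j (- (alpha * x 0 j ^+ 2)).
  by rewrite sumrN -mulr_sumr -enorm_sqr /alpha; ring.
rewrite expR_sum.
have -> : \prod_(j <- s) (1 + `|x 0 j|) =
    \prod_j (if j \in s then 1 + `|x 0 j| else 1).
  by rewrite -big_mkcond /= big_uniq // (subseq_uniq sE) // enum_uniq.
rewrite -big_split /= -[X in _ ^+ X]card_ord -prodr_const.
apply: ler_prod => j _; apply/andP; split.
  rewrite mulr_ge0 ?expR_ge0 //; case: ifP => // _; exact: addr_ge0.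
case: ifP => _; first by rewrite mulrC linear_le_gauss.
rewrite mulr1 (le_trans _ deriv_const_ge1) // -expR0 ler_expR oppr_le0.
by rewrite mulr_ge0 ?sqr_ge0 // ltW.
Qed.

Lemma gauss_mul_derivable j s x : subseq (j :: s) (enum 'I_d) ->
  derivable (foldr (@partial R d) f s) x (dir j).
Proof.
move=> sE; have sE' : subseq s (enum 'I_d).
  by apply: subseq_trans sE; exact: subseq_cons.
apply: (gauss_mul_mixed sE').2.
by have := subseq_uniq sE (enum_uniq _) => /= /andP[].
Qed.

End GaussianProduct.

(** * Distribution functions and clipped quantiles *)

Section ClippedQuantile.
Variables (R : realType) (d : nat) (D : density_vector R d) (j : 'I_d).
Variable L : R -> R.
Hypothesis gL : forall r x : R, `|x| <= r -> 0 < g D j x /\ (g D j x)^-1 <= L r.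

Definition rcdf (x : R) : R := fine (cdf (tau D j) x).

Lemma cdfE x : cdf (tau D j) x = (rcdf x)%:E.
Proof. by rewrite fineK // fin_num_measure. Qed.

Let L0 r : 0 <= r -> 0 < L r.
Proof.
move=> r0; have [|g0 /(lt_le_trans _)] := gL (r := r) (x := 0); first by rewrite normr0.
by apply; rewrite invr_gt0.
Qed.

Lemma distribution_itv x y : x <= y ->
  distribution (dv_prob D) (tau D j) `]x, y]%classic = (rcdf y - rcdf x)%:E.
Proof.
move=> xy.
have E : `]-oo, y]%classic = `]-oo, x]%classic `|` `]x, y]%classic :> set R.
  by rewrite -itv_bndbnd_setU // bnd_simp.
have C z : distribution (dv_prob D) (tau D j) `]-oo, z]%classic = (rcdf z)%:E.
  exact: cdfE.
have : distribution (dv_prob D) (tau D j) `]-oo, y]%classic =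
    (distribution (dv_prob D) (tau D j) `]-oo, x]%classic +
     distribution (dv_prob D) (tau D j) `]x, y]%classic)%E.
  rewrite E; apply: measureU; [exact: measurable_itv|exact: measurable_itv|].
  rewrite -subset0 => z /=; rewrite !in_itv /= => -[zx /andP[xz _]].
  by move: (lt_le_trans xz zx); rewrite ltxx.
by rewrite !C EFinB => ->; rewrite addeAC subee // add0e.
Qed.

Lemma rcdf_le x y : x <= y -> rcdf x <= rcdf y.
Proof. by move=> xy; rewrite -lee_fin -!cdfE cdf_nondecreasing. Qed.

Lemma rcdf_ge0 x : 0 <= rcdf x.
Proof. by rewrite -lee_fin -cdfE cdf_ge0. Qed.

Lemma rcdf_le1 x : rcdf x <= 1.
Proof. by rewrite -lee_fin -cdfE cdf_le1. Qed.

(** The density is at least 1 / L r on [-r, r]. *)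
Lemma rcdf_growth r x y : `|x| <= r -> `|y| <= r -> x <= y ->
  y - x <= L r * (rcdf y - rcdf x).
Proof.
move=> xr yr xy.
have r0 : 0 <= r := le_trans (normr_ge0 x) xr.
rewrite -ler_pdivrMl ?L0 // -lee_fin -distribution_itv //.
rewrite g_density; last exact: measurable_itv.
have -> : ((L r)^-1 * (y - x))%:E =
    (\int[lebesgue_measure]_(z in `]x, y]) (cst (L r)^-1%:E) z)%E.
  have E : lebesgue_measure (`]x, y]%classic : set R) = (y - x)%:E.
    rewrite lebesgue_measure_itv /= lte_fin; case: ltP => [_|yx]; first by rewrite -EFinB.
    by rewrite (le_anti (_ : x <= y <= x)) ?subrr // xy.
  by rewrite integral_cst; [rewrite EFinM -E|exact: measurable_itv].
apply: ge0_le_integral => //.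
- by move=> z _; rewrite lee_fin invr_ge0 ltW // L0.
- apply/measurable_EFinP; apply: measurable_funTS; exact: g_measurable.
- move=> z /=; rewrite in_itv /= => /andP[xz zy].
  have zr : `|z| <= r.
    by rewrite ler_norml; move: xr yr; rewrite !ler_norml; lra.
  have [g0 gLr] := gL zr.
  by rewrite lee_fin -[leRHS]invrK lef_pV2 // posrE ?invr_gt0 // L0.
Qed.

Lemma rcdf_lt x y : x < y -> rcdf x < rcdf y.
Proof.
move=> xy; rewrite -subr_gt0.
have xr : `|x| <= `|x| + `|y| by rewrite lerDl.
have yr : `|y| <= `|x| + `|y| by rewrite lerDr.
have := rcdf_growth xr yr (ltW xy).
move=> /(lt_le_trans _) H; have : 0 < y - x by rewrite subr_gt0.
by move/H; rewrite pmulr_rgt0 // L0 // addr_ge0.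
Qed.

Lemma rcdf_lt1 x : rcdf x < 1.
Proof. by apply: lt_le_trans (rcdf_le1 (x + 1)); rewrite rcdf_lt // ltrDl. Qed.

Lemma rcdf_mono x y : (rcdf x <= rcdf y) = (x <= y).
Proof.
apply/idP/idP; last exact: rcdf_le.
by apply: contraTT; rewrite -!ltNge; exact: rcdf_lt.
Qed.

Lemma rcdf_unbounded y : 0 < y < 1 ->
  (exists x, rcdf x < y) /\ (exists x, y <= rcdf x).
Proof.
move=> /andP[y0 y1]; split.
  have C : rcdf x @[x --> -oo] --> (0 : R) by apply: fine_cvg; exact: cvg_cdfNy0.
  have /= [M [_ HM]] := cvgr_lt _ C _ y0.
  by exists (M - 1); apply: HM; lra.
have C : rcdf x @[x --> +oo] --> (1 : R) by apply: fine_cvg; exact: cvg_cdfy1.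
have /= [M [_ HM]] := cvgr_gt _ C _ y1.
by exists (M + 1); apply/ltW/HM; lra.
Qed.

(** The quantile function cut off at -r and r.  It is defined at every real y,
    so the arguments 0 and 1 are not exceptional. *)
Definition clipped_quantile (r y : R) : R :=
  inf [set x | - r <= x /\ (y <= rcdf x \/ r <= x)].

Section Clip.
Variable r : R.
Hypothesis r0 : 0 <= r.

Let S y := [set x | - r <= x /\ (y <= rcdf x \/ r <= x)].

Let Sr y : S y r.
Proof. by split; [rewrite (le_trans _ r0) // oppr_le0|right]. Qed.

Lemma clipped_quantile_le y x : S y x -> clipped_quantile r y <= x.
Proof. by move=> Sx; apply: ge_inf => //; exists (- r) => z []. Qed.

Lemma le_clipped_quantile y x : (forall z, S y z -> x <= z) ->
  x <= clipped_quantile r y.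
Proof. by move=> H; apply: lb_le_inf; [exists r; exact: Sr|move=> z; exact: H]. Qed.

(** Moving x by L r * (y - y') inside [-r, r] raises the distribution function by
    at least y - y'. *)
Lemma clipped_quantile_lip y y' :
  `|clipped_quantile r y - clipped_quantile r y'| <= L r * `|y - y'|.
Proof.
wlog yy : y y' / y' <= y => [H|].
  have [/H //|/ltW/H] := leP y' y; by rewrite distrC (distrC y).
have mon : clipped_quantile r y' <= clipped_quantile r y.
  apply: le_clipped_quantile => z [zr Hz]; apply: clipped_quantile_le; split => //.
  by case: Hz => [Hz|]; [left; exact: le_trans Hz|right].
rewrite !ger0_norm ?subr_ge0 // lerBlDl -lerBlDr.
apply: le_clipped_quantile => z [zr Hz]; rewrite lerBlDr.
set e := L r * (y - y').
have e0 : 0 <= e by rewrite mulr_ge0 ?subr_ge0 // ltW // L0.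
apply: clipped_quantile_le; split; first by rewrite (le_trans zr) // lerDl.
have [|zer] := leP r (z + e); first by right.
left; case: Hz => Hz; last first.
  by have := lt_le_trans zer Hz; rewrite ltNge lerDl e0.
have ez : `|z + e| <= r by rewrite ler_norml (le_trans zr) ?lerDl //= ltW.
have zr' : `|z| <= r by rewrite ler_norml zr /= (le_trans _ (ltW zer)) // lerDl.
have := rcdf_growth zr' ez; rewrite lerDl e0 => /(_ isT).
rewrite addrC addKr {1}/e ler_pM2l ?L0 //; lra.
Qed.

Lemma clipped_quantile_rcdf x :
  clipped_quantile r (rcdf x) = x \/
  (r <= `|x| /\ r <= `|clipped_quantile r (rcdf x)|).
Proof.
have [rx|xr] := leP r `|x|; last first.
  left; move: xr; rewrite ltr_norml => /andP[rx xr].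
  apply/eqP; rewrite eq_le; apply/andP; split.
    by apply: clipped_quantile_le; split; [exact: ltW|left].
  apply: le_clipped_quantile => z [_ [|rz]]; first by rewrite rcdf_mono.
  by rewrite (le_trans (ltW xr)).
right; split => //; move: rx; rewrite ler_normr => /orP[rx|rx].
  rewrite ler_normr; apply/orP; left.
  apply: le_clipped_quantile => z [_ [|//]]; rewrite rcdf_mono; exact: le_trans.
rewrite ler_normr; apply/orP; right; rewrite lerNr.
apply: clipped_quantile_le; split => //; left; rewrite rcdf_mono; lra.
Qed.

Lemma quantile_clip y : 0 < y < 1 ->
  quantile D j y = clipped_quantile r y \/
  (r <= `|quantile D j y| /\ r <= `|clipped_quantile r y|).
Proof.
move=> y01; have [[x0 x0y] [x1 yx1]] := rcdf_unbounded y01.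
have E : [set x | (y%:E <= cdf (tau D j) x)%E] = [set x | y <= rcdf x].
  by apply/funext => x; rewrite /= cdfE lee_fin.
rewrite /quantile E; set Q := inf _.
have Qlb : lbound [set x | y <= rcdf x] x0.
  move=> z /= yz; rewrite -rcdf_mono ltW //; exact: lt_le_trans yz.
have QS z : y <= rcdf z -> Q <= z.
  by move=> yz; apply: ge_inf => //; exists x0.
have Q_lt z : Q < z -> y <= rcdf z.
  move=> Qz; have [|u yu uz] := inf_lt _ Qz; first by exists x1.
  by rewrite (le_trans yu) // rcdf_le // ltW.
have [rQ|Qr] := leP r Q.
  right; split; first by rewrite ler_normr rQ.
  rewrite ler_normr; apply/orP; left; apply: le_clipped_quantile => z [_ [/QS|//]].
  exact: le_trans.
have [rQ|Qr'] := leP Q (- r).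
  right; split; first by rewrite ler_normr; apply/orP; right; rewrite lerNr.
  rewrite ler_normr; apply/orP; right; rewrite lerNr.
  apply/ler_addgt0Pr => e e0; apply: clipped_quantile_le; split.
    by rewrite lerDl ltW.
  by left; apply: Q_lt; rewrite (le_lt_trans rQ) // ltrDl.
left; apply/eqP; rewrite eq_le; apply/andP; split.
  apply: le_clipped_quantile => z [_ [/QS//|rz]]; exact: le_trans (ltW Qr) rz.
apply/ler_addgt0Pr => e e0; apply: clipped_quantile_le; split.
  by rewrite (le_trans (ltW Qr')) // lerDl ltW.
by left; apply: Q_lt; rewrite ltrDl.
Qed.

End Clip.

(** The intervals ]a - 1/n, a + 1/n] decrease to a point, which has measure zero
    because the law has a density. *)
Lemma rcdf_no_jump a e : 0 < e ->
  exists2 h : R, 0 < h & rcdf (a + h) - rcdf (a - h) < e.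
Proof.
move=> e0.
pose J n : set R := `]a - n.+1%:R^-1, a + n.+1%:R^-1]%classic.
have capJ : \bigcap_n J n `<=` [set a].
  move=> x Ix /=; apply/eqP; rewrite eq_le; apply/andP; split.
    apply/ler_addgt0Pr => u u0.
    have [n _ /(_ n (leqnn n)) nu] := near_infty_natSinv_lt (PosNum u0).
    by have := Ix n Logic.I; rewrite /J /= in_itv /= => /andP[_ /le_trans]; apply;
      rewrite lerD2l ltW.
  apply/ler_addgt0Pr => u u0.
  have [n _ /(_ n (leqnn n)) nu] := near_infty_natSinv_lt (PosNum u0).
  have := Ix n Logic.I; rewrite /J /= in_itv /= => /andP[ax _].
  rewrite -lerBlDr (le_trans _ (ltW ax)) // lerD2l lerN2; exact: ltW.
have mJ n : measurable (J n) by exact: measurable_itv.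
have H0 : distribution (dv_prob D) (tau D j) (\bigcap_n J n) = 0%E.
  rewrite g_density; last exact: bigcapT_measurable.
  exact: integral_Sset1 capJ.
have : (distribution (dv_prob D) (tau D j) \o J) x @[x --> \oo] -->
    distribution (dv_prob D) (tau D j) (\bigcap_n J n).
  apply: nonincreasing_cvg_mu; [|exact: mJ|exact: bigcapT_measurable|].
    by rewrite (le_lt_trans (probability_le1 _ (mJ _))) // ltry.
  move=> m n mn; apply/subsetPset => x; rewrite /J /= !in_itv /= => /andP[ax xa].
  have nm : n.+1%:R^-1 <= m.+1%:R^-1 :> R by rewrite lef_pV2 ?posrE // ler_nat.
  apply/andP; split; first by rewrite (le_lt_trans _ ax) // lerD2l lerN2.
  by rewrite (le_trans xa) // lerD2l.
rewrite H0.
move=> /fine_cvg /cvgr_lt /(_ _ e0) [n _ /(_ n (leqnn n)) /= H].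
have n0 : 0 < n.+1%:R^-1 :> R by rewrite invr_gt0.
exists n.+1%:R^-1 => //; move: H; rewrite /J distribution_itv //.
by move: n0; set u := _^-1 => n0; lra.
Qed.

Lemma measurable_rcdf_lt y : measurable [set x | rcdf x < y].
Proof.
have := cdf_measurable (tau D j) measurableT (emeasurable_itv `]-oo, y%:E[).
rewrite setTI; congr measurable; apply/funext => x /=.
by rewrite in_itv /= cdfE lte_fin.
Qed.

(** The distribution function of a continuous variable, applied to the variable,
    is uniform.  At the quantile Q of order y both y and the probability lie
    between the values at Q - h and Q + h, which are arbitrarily close. *)
Lemma distribution_rcdf_lt y : 0 <= y <= 1 ->
  distribution (dv_prob D) (tau D j) [set x | rcdf x < y] = y%:E.
Proof.
rewrite le_eqVlt => /andP[/predU1P[<- _|y0]].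
  rewrite (_ : [set x | _] = set0) ?measure0 //.
  by rewrite -subset0 => x /=; rewrite ltNge rcdf_ge0.
rewrite le_eqVlt => /predU1P[->|y1].
  rewrite (_ : [set x | _] = setT); first exact: probability_setT.
  by apply/funext => x; rewrite /= rcdf_lt1; apply/propext.
have y01 : 0 < y < 1 by rewrite y0.
have [[x0 x0y] [x1 yx1]] := rcdf_unbounded y01.
set A := [set x | _]; set p := distribution _ _ A.
have mA : measurable A := measurable_rcdf_lt y.
pose Q := inf [set x | y <= rcdf x].
have Qlb : lbound [set x | y <= rcdf x] x0.
  move=> z /= yz; rewrite -rcdf_mono ltW //; exact: lt_le_trans yz.
have pE : p = (fine p)%:E by rewrite fineK // fin_num_measure.
have close e : 0 < e -> `|fine p - y| < e.
  move=> e0; have [h h0 he] := rcdf_no_jump Q e0.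
  have yh : y <= rcdf (Q + h).
    have Qh : Q < Q + h by rewrite ltrDl.
    have [|u yu uz] := inf_lt _ Qh; first by exists x1.
    by rewrite (le_trans yu) // rcdf_le // ltW.
  have hy : rcdf (Q - h) < y.
    rewrite ltNge; apply/negP => H.
    have : Q <= Q - h by apply: ge_inf => //; exists x0.
    by rewrite lerBrDr gerDl leNgt h0.
  have ph : fine p <= rcdf (Q + h).
    rewrite -lee_fin -pE -cdfE /cdf; apply: le_measure; rewrite ?inE //.
    move=> x /=; rewrite in_itv /= => xy.
    by rewrite -rcdf_mono (le_trans (ltW xy)).
  have hp : rcdf (Q - h) <= fine p.
    rewrite -lee_fin -pE -cdfE /cdf; apply: le_measure; rewrite ?inE //.
    by move=> x /=; rewrite in_itv /= -rcdf_mono => /le_lt_trans; apply.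
  rewrite ltr_norml; lra.
rewrite pE; congr EFin; apply/eqP; rewrite -subr_eq0 -normr_le0.
by apply/ler_addgt0Pr => e /close /ltW; rewrite add0r.
Qed.

Lemma integral_density_cell (y1 y2 : R) : 0 <= y1 -> y1 <= y2 -> y2 <= 1 ->
  (\int[lebesgue_measure]_(x in [set x | (y1 <= rcdf x < y2)%R]) (g D j x)%:E)%E
  = (y2 - y1)%:E.
Proof.
move=> y10 y12 y21.
have E : [set x | y1 <= rcdf x < y2] =
    [set x | rcdf x < y2] `\` [set x | rcdf x < y1].
  apply/seteqP; split => x /=.
    by move=> /andP[xy ->]; split => //; apply/negP; rewrite -leNgt.
  by move=> [-> /negP]; rewrite -leNgt => ->.
have m1 := measurable_rcdf_lt y1; have m2 := measurable_rcdf_lt y2.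
rewrite -g_density E; last exact: measurableD.
rewrite measureD // ?(setIidr _); last first.
- by rewrite (le_lt_trans (probability_le1 _ m2)) // ltry.
- by move=> x /= xy; rewrite (lt_le_trans xy).
rewrite EFinB; congr (_ - _)%E; apply: distribution_rcdf_lt; apply/andP; split=> //; lra.
Qed.

End ClippedQuantile.

(** * Integrals of products of independent variables *)

Section WeightedIntegral.
Local Open Scope ereal_scope.
Context d (T : measurableType d) (R : realType).
Variables (mu : {measure set T -> \bar R}) (X : T -> R).
Hypothesis mX : measurable_fun setT X.
Variables (xi : T -> R) (nu : {measure set R -> \bar R}) (e : R).
Hypothesis xi0 : forall x, (0 <= xi x)%R.
Hypothesis mxi : measurable_fun setT xi.
Hypothesis H : forall A, measurable A ->
  \int[mu]_x ((xi x)%:E * (\1_A (X x))%:E) = e%:E * nu A.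

Let Xi x := (xi x)%:E.
Let Xi0 x : 0 <= Xi x. Proof. by rewrite lee_fin. Qed.
Let mXi : measurable_fun setT Xi. Proof. exact/measurable_EFinP. Qed.

Import HBNNSimple.

Let weighted_integral_simple (h : {nnsfun R >-> R}) :
  \int[mu]_x (Xi x * (h (X x))%:E) = e%:E * \int[nu]_x (h x)%:E.
Proof.
have mh y : measurable (h @^-1` [set y]) by exact: measurable_sfunP.
have term_ge0 y z : 0 <= (y * \1_(h @^-1` [set y]) z)%:E.
  by rewrite EFinM nnfun_muleindic_ge0.
have hE z : (h z)%:E = \sum_(y \in range h) (y * \1_(h @^-1` [set y]) z)%:E.
  by rewrite fsumEFin // -fimfunE.
have mterm y : measurable_fun setT (fun z => (y * \1_(h @^-1` [set y]) z)%:E).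
  by apply/measurable_EFinP; apply: measurable_funM => //.
transitivity (\int[mu]_x \sum_(y \in range h)
    (Xi x * (y * \1_(h @^-1` [set y]) (X x))%:E)).
  by apply: eq_integral => x _; rewrite hE ge0_mule_fsumr.
rewrite ge0_integral_fsum //; last 2 first.
- move=> y; apply: emeasurable_funM => //.
  exact: (measurableT_comp (mterm y) mX).
- by move=> y x _; rewrite mule_ge0.
under [in RHS]eq_integral do rewrite hE.
rewrite [in RHS]ge0_integral_fsum //.
rewrite ge0_mule_fsumr; last by move=> y; apply: integral_ge0 => z _.
apply: eq_fsbigr => y _.
have [y0|y0] := ltP y 0%R.
  rewrite (preimage_nnfun0 _ y0) indic0.
  rewrite !integral0_eq ?mule0 // => x _; by rewrite /= mulr0 ?mule0.
under eq_integral do rewrite EFinM muleCA.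
rewrite ge0_integralZl //; last 2 first.
- apply: emeasurable_funM => //.
  have m1 : measurable_fun setT (fun z => (\1_(h @^-1` [set y]) z)%:E : \bar R).
    by apply/measurable_EFinP; exact: measurable_indic.
  exact: (measurableT_comp m1 mX).
- by move=> x _; rewrite mule_ge0 // lee_fin.
rewrite H //; under [in RHS]eq_integral do rewrite EFinM.
rewrite ge0_integralZl //; last by apply/measurable_EFinP; exact: measurable_indic.
by rewrite integral_indic // setIT muleCA.
Qed.

(** If weighting mu by xi gives X the law e * nu on sets, then it does so on
    nonnegative functions, by approximation with simple functions.  This serves
    both for a density (X the identity) and for a product of independent factors
    (xi the product of the other factors). *)
Lemma weighted_integral (u : R -> \bar R) : measurable_fun setT u ->
  (forall y, 0 <= u y) ->
  \int[mu]_x ((xi x)%:E * u (X x)) = e%:E * \int[nu]_y u y.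
Proof.
move=> mu_ u0.
pose h := nnsfun_approx measurableT mu_.
have hu y : (h n y)%:E @[n --> \oo] --> u y by exact: cvg_nnsfun_approx.
have ndh y : {homo (fun n => (h n y)%:E) : m n / (m <= n)%N >-> m <= n}.
  by move=> m n mn; rewrite lee_fin; exact/lefP/nd_nnsfun_approx.
have mhE n : measurable_fun setT (fun y => (h n y)%:E).
  by apply/measurable_EFinP.
transitivity (limn (fun n => \int[mu]_x (Xi x * (h n (X x))%:E))).
  rewrite -monotone_convergence //.
  - apply: eq_integral => x _; apply/esym/cvg_lim => //.
    by apply: cvgeZl => //; exact: hu.
  - move=> n; apply: emeasurable_funM => //; exact: (measurableT_comp (mhE n) mX).
  - by move=> n x _; rewrite mule_ge0 // lee_fin.
  - by move=> x _ m n mn; rewrite lee_wpmul2l // ndh.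
transitivity (limn (fun n => e%:E * \int[nu]_y (h n y)%:E)).
  by congr (limn _); apply/funext => n; exact: weighted_integral_simple.
have -> : \int[nu]_y u y = limn (fun n => \int[nu]_y (h n y)%:E).
  rewrite -monotone_convergence //.
  - by apply: eq_integral => y _; apply/esym/cvg_lim.
  - by move=> n y _; rewrite lee_fin.
apply/cvg_lim => //; apply: cvgeZl => //.
apply: ereal_nondecreasing_is_cvgn => m n mn; apply: ge0_le_integral => //.
- by move=> y _; rewrite lee_fin.
- by move=> y _; exact: ndh.
Qed.

End WeightedIntegral.

Section IndependentProduct.
Context dT (T : measurableType dT) (R : realType) (P : probability T R).
Variables (d : nat) (W : 'I_d -> {RV P >-> R}).
Hypothesis hW : mutually_independent P (@measurable _ R) (fun j => W j : T -> R).

Lemma indic_bigI (I : Type) (s : seq I) (B : I -> set T) x :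
  \1_(\big[setI/setT]_(i <- s) B i) x = \prod_(i <- s) \1_(B i) x :> R.
Proof.
elim: s => [|i s IH]; first by rewrite !big_nil indicT.
by rewrite !big_cons indicI /= IH.
Qed.

Lemma measurable_fun_prod_seq (I : Type) (s : seq I) (F : I -> T -> R) :
  (forall i, measurable_fun setT (F i)) ->
  measurable_fun setT (fun x => \prod_(i <- s) F i x).
Proof.
move=> mF; elim: s => [|i s IH].
  by under eq_fun do rewrite big_nil; exact: measurable_cst.
by under eq_fun do rewrite big_cons; exact: measurable_funM.
Qed.

Variables (u : 'I_d -> R -> R) (c : 'I_d -> R).
Hypothesis u0 : forall j y, 0 <= u j y.
Hypothesis mu : forall j, measurable_fun setT (u j).
Hypothesis uc : forall j, (\int[P]_v (u j (W j v))%:E)%E = (c j)%:E.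

(** For s empty this is the definition of independence on measurable sets; then
    indicators are replaced by the functions u j one coordinate at a time. *)
Let integral_indep (s : seq 'I_d) (A : 'I_d -> set R) : uniq s ->
  (forall j, measurable (A j)) ->
  (\int[P]_v (\prod_j (if j \in s then u j (W j v) else \1_(A j) (W j v)))%:E)%E =
  (\prod_j (if j \in s then c j else fine (P (W j @^-1` A j))))%:E.
Proof.
have mWA j B : measurable B -> measurable (W j @^-1` B).
  by move=> mB; rewrite -[X in measurable X]setTI; exact: measurable_funP.
elim: s A => [|i s IH] A /=.
  move=> _ mA.
  under eq_integral => v _.
    rewrite (eq_bigr (fun j => \1_(W j @^-1` A j) v)) //.
    rewrite -[\prod_j _]big_enum -indic_bigI /=; over.
  rewrite integral_indic //; last first.
    by apply: bigsetI_measurable => j _; exact: mWA.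
  rewrite setIT; apply: (etrans (hW (enum_uniq _) (fun i _ => mA i))).
  rewrite big_enum /= -prodEFin.
  by apply: eq_bigr => j _; rewrite fineK // fin_num_measure //; exact: mWA.
move=> /andP[iNs us] mA.
pose xi v := \prod_(j | j != i) (if j \in s then u j (W j v) else \1_(A j) (W j v)).
pose e := \prod_(j | j != i) (if j \in s then c j else fine (P (W j @^-1` A j))).
have xi0 v : 0 <= xi v.
  by apply: prodr_ge0 => j _; case: ifP => // _; exact: indic_ge0.
have mxi : measurable_fun setT xi.
  rewrite /xi; under eq_fun do rewrite -big_filter.
  apply: measurable_fun_prod_seq => j; case: (j \in s).
    exact: (measurableT_comp (mu j)).
  have m1 : measurable_fun setT (\1_(A j) : R -> R) by exact: measurable_indic.
  exact: (measurableT_comp m1).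
transitivity (\int[P]_v ((xi v)%:E * (u i (W i v))%:E))%E.
  apply: eq_integral => v _; rewrite -EFinM; congr EFin.
  rewrite (bigD1 i) //= inE eqxx /= mulrC; congr (_ * _).
  by apply: eq_bigr => j /negPf ji; rewrite inE ji.
have WI B : measurable B ->
    (\int[P]_v ((xi v)%:E * (\1_B (W i v))%:E) = e%:E * distribution P (W i) B)%E.
  move=> mB; have E := IH (fun j => if j == i then B else A j) us.
  transitivity (\prod_j (if j \in s then c j
      else fine (P (W j @^-1` (if j == i then B else A j)))))%:E.
    rewrite -E => [|j]; last by case: eqP.
    apply: eq_integral => v _; rewrite -EFinM; congr EFin.
    rewrite [RHS](bigD1 i) //= (negPf iNs) eqxx mulrC; congr (_ * _).
    by apply: eq_bigr => j /negPf ji; rewrite ji.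
  rewrite (bigD1 i) //= (negPf iNs) eqxx mulrC EFinM; congr (_ * _)%E.
    by congr EFin; apply: eq_bigr => j /negPf ji; rewrite ji.
  by rewrite fineK // fin_num_measure //; exact: mWA.
have mui : measurable_fun setT (fun y => (u i y)%:E) by exact/measurable_EFinP.
have uE0 y : (0 <= (u i y)%:E)%E by rewrite lee_fin.
rewrite (@weighted_integral _ _ _ P (W i) (measurable_funP (W i)) xi
  (distribution P (W i)) e xi0 mxi WI (fun y => (u i y)%:E)) //.
rewrite ge0_integral_distribution //.
transitivity (e%:E * (c i)%:E)%E; first by congr (_ * _)%E; exact: uc.
rewrite -EFinM; congr EFin.
rewrite [RHS](bigD1 i) //= inE eqxx /= mulrC; congr (_ * _).
by apply: eq_bigr => j /negPf ji; rewrite inE ji.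
Qed.

Lemma integral_prod_indep :
  (\int[P]_v (\prod_j u j (W j v))%:E)%E = (\prod_j c j)%:E.
Proof.
have := integral_indep (enum_uniq 'I_d) (fun=> measurableT).
under eq_integral do under eq_bigr do rewrite mem_enum /=.
by under [in RHS]eq_bigr do rewrite mem_enum /=.
Qed.

End IndependentProduct.

(** * Base-b digits of real numbers and of scrambled coordinates *)

Section Digits.
Variables (R : realType) (b : nat).
Hypothesis hb : (1 < b)%N.

Let b0 : (b%:R : R) != 0.
Proof. by rewrite pnatr_eq0 -lt0n ltnW. Qed.
Let bp : (0 : R) < b%:R.
Proof. by rewrite ltr0n ltnW. Qed.

(** The integer with base-b digits a 0, ..., a (l - 1), leading digit first. *)
Fixpoint horner_nat (a : nat -> nat) (l : nat) : nat :=
  if l is l'.+1 then (horner_nat a l' * b + a l')%N else 0%N.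

Lemma horner_nat_lt a l : (forall i, a i < b)%N -> (horner_nat a l < b ^ l)%N.
Proof.
move=> ab; elim: l => //= l IH; rewrite expnS.
have := ab l; move: IH; set u := horner_nat a l; set v := (b ^ l)%N; nia.
Qed.

Lemma horner_nat_inj a a' l : (forall i, a i < b)%N -> (forall i, a' i < b)%N ->
  horner_nat a l = horner_nat a' l -> forall i, (i < l)%N -> a i = a' i.
Proof.
move=> ab ab'; elim: l => //= l IH E i.
have Em := congr1 (modn^~ b) E; have Ed := congr1 (divn^~ b) E.
rewrite /= !modnMDl !modn_small // in Em.
rewrite /= !divnMDl ?(ltnW hb) // !divn_small // !addn0 in Ed.
by rewrite ltnS leq_eqVlt => /predU1P[->//|]; exact: IH.
Qed.

Lemma eq_horner_nat a a' l : (forall i, (i < l)%N -> a i = a' i) ->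
  horner_nat a l = horner_nat a' l.
Proof.
elim: l => //= l IH E; rewrite E // IH // => i il; rewrite E // ltnW //.
Qed.

Lemma horner_nat_sum a l :
  (horner_nat a l)%:R / b%:R ^+ l = \sum_(1 <= i < l.+1) (a i.-1)%:R / b%:R ^+ i :> R.
Proof.
elim: l => [|l IH]; first by rewrite big_geq // mul0r.
rewrite big_nat_recr //= -IH natrD natrM exprS; field.
by rewrite expf_neq0 // b0.
Qed.

Lemma truncn_digits (x : R) l : 0 <= x < 1 ->
  Num.truncn (x * b%:R ^+ l) = horner_nat (fun i => digit hb x i.+1) l.
Proof.
move=> /andP[x0 x1]; elim: l => [|l IH] /=.
  by apply: truncn_def; rewrite expr0 mulr1 x0.
rewrite -IH [LHS](divn_eq _ b); congr (_ * _ + _)%N.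
set y := x * b%:R ^+ l.
have -> : x * b%:R ^+ l.+1 = y * b%:R by rewrite exprSr mulrA.
have y0 : 0 <= y by rewrite mulr_ge0 ?exprn_ge0 // ltW.
have yb0 : 0 <= y * b%:R by rewrite mulr_ge0 // ltW.
have /andP[t1 t2] := truncn_itv yb0.
apply/esym/truncn_def; apply/andP; split.
  rewrite -(ler_pM2r bp); apply: le_trans t1.
  by rewrite -natrM ler_nat leq_trunc_div.
rewrite -(ltr_pM2r bp); apply: lt_le_trans t2 _.
by rewrite -natrM ler_nat ltn_ceil // ltnW.
Qed.

Section Columns.
Variable N : nat.
Local Notation column := {ffun 'I_N -> 'I_b}.

Definition digit_at (z : column) (i : nat) : nat :=
  if insub i is Some k then z k else 0%N.

Lemma digit_at_lt z i : (digit_at z i < b)%N.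
Proof. by rewrite /digit_at; case: insub => // ; exact: ltnW. Qed.

Lemma digit_at_ord z (i : 'I_N) : digit_at z i = z i.
Proof. by rewrite /digit_at valK. Qed.

Definition cell_index (l : nat) (z : column) := horner_nat (digit_at z) l.

Lemma cell_index_agree l (z z' : column) : (l <= N)%N ->
  (cell_index l z == cell_index l z') = agree l z z'.
Proof.
move=> lN; apply/eqP/agreeP => [E i il|E].
  apply: val_inj; rewrite /= -!digit_at_ord.
  by apply: horner_nat_inj E _ il => ?; exact: digit_at_lt.
apply: eq_horner_nat => i il; have iN := leq_trans il lN.
have := congr1 (@nat_of_ord b) (E (Ordinal iN) il); by rewrite -!digit_at_ord.
Qed.

Lemma cell_index_lt l z : (cell_index l z < b ^ l)%N.
Proof. by apply: horner_nat_lt => i; exact: digit_at_lt. Qed.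

Definition cell_left (z : column) : R := (cell_index N z)%:R / b%:R ^+ N.

Definition column_of (x : R) : column := [ffun i : 'I_N => digit hb x i.+1].

Lemma cell_index_column_of (x : R) l : 0 <= x < 1 -> (l <= N)%N ->
  cell_index l (column_of x) = Num.truncn (x * b%:R ^+ l).
Proof.
move=> x01 lN; rewrite truncn_digits //; apply: eq_horner_nat => i il.
have := digit_at_ord (column_of x) (Ordinal (leq_trans il lN)).
by rewrite ffunE.
Qed.

(** Having the N leading digits of z is lying in an interval of length b^-N; this
    translates the combinatorial cells into elementary intervals. *)
Lemma column_ofE (x : R) z : 0 <= x < 1 ->
  (column_of x == z) = (cell_left z <= x < cell_left z + b%:R ^- N).
Proof.
move=> x01; have /andP[x0 x1] := x01.
rewrite -agree_full -cell_index_agree // cell_index_column_of //.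
have bN : (0 : R) < b%:R ^+ N by rewrite exprn_gt0.
rewrite /cell_left ler_pdivrMr // -[X in _ + X]mul1r -mulrDl ltr_pdivlMr // natr1.
by rewrite truncn_eq // mulr_ge0 // ltW.
Qed.

Lemma cell_left_agree l z z' : (l <= N)%N -> agree l z z' ->
  `|cell_left z - cell_left z'| <= b%:R ^- l.
Proof.
move=> lN; rewrite -cell_index_agree // => /eqP E.
have H (w : column) n : (l <= n <= N)%N ->
    (cell_index l w)%:R / b%:R ^+ l <= (cell_index n w)%:R / b%:R ^+ n :> R /\
    (cell_index n w)%:R / b%:R ^+ n <=
      (cell_index l w)%:R / b%:R ^+ l + b%:R ^- l - b%:R ^- n :> R.
  move=> /andP[ln nN]; rewrite -(subnKC ln); move: (n - l)%N => r {n ln nN}.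
  elim: r => [|r [IH1 IH2]]; first by rewrite addn0 addrK.
  rewrite addnS /cell_index /= -/(cell_index (l + r) w).
  have pr : (0 : R) < b%:R ^+ (l + r) by rewrite exprn_gt0.
  have D : ((cell_index (l + r) w * b + digit_at w (l + r))%N)%:R / b%:R ^+ (l + r).+1 =
      (cell_index (l + r) w)%:R / b%:R ^+ (l + r) +
      (digit_at w (l + r))%:R / b%:R ^+ (l + r).+1 :> R.
    rewrite natrD natrM exprS; field; by rewrite b0 gt_eqF.
  rewrite D; split; first by rewrite (le_trans IH1) // lerDl divr_ge0 // exprn_ge0 // ltW.
  have dl : (digit_at w (l + r))%:R / b%:R ^+ (l + r).+1 <=
      b%:R ^- (l + r) - b%:R ^- (l + r).+1 :> R.
    have -> : b%:R ^- (l + r) = b%:R / b%:R ^+ (l + r).+1 :> R.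
      by rewrite exprS invfM mulrA divff // mul1r.
    rewrite -[X in _ - X]mul1r -mulrBl ler_wpM2r ?invr_ge0 ?exprn_ge0 ?(ltW bp) //.
    by rewrite lerBrDr natr1 ler_nat digit_at_lt.
  lra.
have [|h1 h2] := H z N; first by rewrite lN leqnn.
have [|h1' h2'] := H z' N; first by rewrite lN leqnn.
rewrite -/(cell_left z) in h1 h2; rewrite -/(cell_left z') in h1' h2'.
have : (0 : R) <= b%:R ^- N by rewrite invr_ge0 exprn_ge0 // ltW.
rewrite -E in h1' h2'; rewrite ler_norml; lra.
Qed.

Lemma cell_left_ge0 z : 0 <= cell_left z.
Proof. by rewrite divr_ge0 // exprn_ge0 // ltW. Qed.

Lemma cell_right_le1 z : cell_left z + b%:R ^- N <= 1.
Proof.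
have bN : (0 : R) < b%:R ^+ N by rewrite exprn_gt0.
rewrite /cell_left -[X in _ + X]mul1r -mulrDl ler_pdivrMr // mul1r natr1.
by rewrite -natrX ler_nat cell_index_lt.
Qed.

End Columns.

Section ScrambledDigits.
Variables (N d : nat).
Local Notation column := {ffun 'I_N -> 'I_b}.
Variable perms : seq 'I_b -> 'S_b.
Variable x : R.

Definition scramble_column : column :=
  [ffun i : 'I_N => perms (prefix_of i (column_of N x)) (column_of N x i)].

Let a (i : nat) : nat := perms [seq digit hb x l | l <- iota 1 i] (digit hb x i.+1).

Let ab i : (a i < b)%N. Proof. exact: ltn_ord. Qed.

Lemma prefix_of_column_of (i : nat) : (i <= N)%N ->
  prefix_of i (column_of N x) = [seq digit hb x l | l <- iota 1 i].
Proof.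
move=> iN; rewrite (iotaDl 1 0) -map_comp.
have -> : iota 0 i = [seq val k | k <- [seq k : 'I_N <- enum 'I_N | (k < i)%N]].
  rewrite -(filter_map val (fun k => k < i)%N) val_enum_ord.
  by rewrite [RHS](filter_iota_ltn 0 iN).
rewrite -map_comp; apply: eq_map => k /=; by rewrite ffunE.
Qed.

Let partial_sum (n : nat) : R := (horner_nat a n)%:R / b%:R ^+ n.

Lemma scramble_columnE : cell_left scramble_column = partial_sum N.
Proof.
congr (_%:R / _); apply: eq_horner_nat => i iN.
rewrite -[i in LHS]/(val (Ordinal iN)) digit_at_ord ffunE /=.
by rewrite prefix_of_column_of ?(ltnW iN) // ffunE.
Qed.

Let partial_sumS n :
  partial_sum n.+1 = partial_sum n + (a n)%:R / b%:R ^+ n.+1.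
Proof. by rewrite /partial_sum !horner_nat_sum big_nat_recr. Qed.

Let partial_sum_le n : partial_sum n <= partial_sum n.+1.
Proof. by rewrite partial_sumS lerDl divr_ge0 // exprn_ge0 // ltW. Qed.

Let partial_sum_ub n : partial_sum n.+1 + b%:R ^- n.+1 <= partial_sum n + b%:R ^- n.
Proof.
rewrite partial_sumS -addrA lerD2l.
have -> : b%:R ^- n = b%:R / b%:R ^+ n.+1 :> R.
  by rewrite exprS invfM mulrA divff // mul1r.
rewrite -[X in _ + X]mul1r -mulrDl ler_wpM2r ?invr_ge0 ?exprn_ge0 ?(ltW bp) //.
by rewrite natr1 ler_nat.
Qed.

(** The partial sums of the series of scrambled digits increase, while adding to
    each of them the largest possible remainder gives a decreasing sequence. *)
Lemma scramble_coord_near :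
  cell_left scramble_column <= scramble_coord hb perms x <=
    cell_left scramble_column + b%:R ^- N.
Proof.
have nd : {homo partial_sum : m n / (m <= n)%N >-> m <= n}.
  by apply/nondecreasing_seqP.
have ni : {homo (fun n => partial_sum n + b%:R ^- n) : m n / (m <= n)%N >-> n <= m}.
  by apply/nonincreasing_seqP => n; exact: partial_sum_ub.
have ub n m : (m <= n)%N -> partial_sum n <= partial_sum m + b%:R ^- m.
  move=> mn; apply: le_trans (ni _ _ mn).
  by rewrite lerDl invr_ge0 exprn_ge0 // ltW.
have cvg_ps : cvgn partial_sum.
  apply: nondecreasing_is_cvgn => //; exists (partial_sum N + b%:R ^- N).
  move=> _ [n _ <-]; have [nN|/ltnW Nn] := leqP N n; first exact: ub.
  by rewrite (le_trans (nd _ _ Nn)) // lerDl invr_ge0 exprn_ge0 // ltW.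
have E : scramble_coord hb perms x = limn partial_sum.
  rewrite /scramble_coord; congr (limn _); apply/funext => n.
  by rewrite /partial_sum horner_nat_sum; apply: eq_big_nat => i /andP[i0 _];
    rewrite /a prednK.
rewrite E scramble_columnE; apply/andP; split.
  by apply: limr_ge => //; exists N => // n /= Nn; exact: nd.
by apply: limr_le => //; exists N => // n /= Nn; exact: ub.
Qed.

End ScrambledDigits.

End Digits.

(** * Expectations compared cell by cell *)

Section LowerIntegral.
Local Open Scope ereal_scope.
Context dT (T : measurableType dT) (R : realType).
Variable mu : {measure set T -> \bar R}.

(** The integral of a nonnegative function is a supremum over the simple functions
    below it.  It therefore remains monotone for functions whose measurability is
    not known, such as the squared error and h(W). *)
Lemma ge0_le_integral_nonmeas (f1 f2 : T -> \bar R) :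
  (forall x, 0 <= f1 x) -> (forall x, f1 x <= f2 x) ->
  \int[mu]_x f1 x <= \int[mu]_x f2 x.
Proof.
move=> f10 f12; have f20 x : 0 <= f2 x by exact: le_trans (f12 x).
rewrite !ge0_integralTE //; apply: le_ereal_sup => _ /= [h hf <-].
by exists h => // x; exact: le_trans (f12 x).
Qed.

Variables (I : finType) (rho : I -> T -> R) (p : R).
Hypothesis rho0 : forall c v, (0 <= rho c v)%R.
Hypothesis mrho : forall c, measurable_fun setT (rho c).
Hypothesis int_rho : forall c, \int[mu]_v (rho c v)%:E = p%:E.

Lemma integral_cells (K : I -> R) : (forall c, (0 <= K c)%R) ->
  \int[mu]_v (\sum_c K c * rho c v)%:E = ((\sum_c K c) * p)%:E.
Proof.
move=> K0; under eq_integral do rewrite -sumEFin.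
rewrite ge0_integral_sum //; last 2 first.
- move=> c; apply/measurable_EFinP; exact: measurable_funM.
- by move=> c v _; rewrite lee_fin mulr_ge0.
rewrite mulr_suml -sumEFin; apply: eq_bigr => c _.
under eq_integral do rewrite EFinM.
rewrite ge0_integralZl ?lee_fin //; [by rewrite int_rho|exact/measurable_EFinP|].
by move=> v _; rewrite lee_fin.
Qed.
End LowerIntegral.

Section CellExpectation.
Context dT (T : measurableType dT) (R : realType).
Variable P : probability T R.
Variables (I : finType) (rho : I -> T -> R) (p : R).
Hypothesis rho0 : forall c v, (0 <= rho c v)%R.
Hypothesis mrho : forall c, measurable_fun setT (rho c).
Hypothesis int_rho : forall c, (\int[P]_v (rho c v)%:E)%E = p%:E.
Hypothesis p_total : #|I|%:R * p = 1.
Variable cell : T -> I.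
Hypothesis rho_cell : forall c v, c != cell v -> rho c v = 0.

(** The positive and the negative part of X are enclosed between finite sums of
    the weights rho c, whose integrals are known. *)
Lemma expectation_cells (X : T -> R) (H : I -> R) (e : R) : 0 <= e ->
  (forall v, `|X v - H (cell v) * rho (cell v) v| <= e * rho (cell v) v) ->
  `|fine ('E_P[X])%E - (\sum_c H c) * p| <= 2 * e.
Proof.
move=> e0 HX.
have sum_cell (K : I -> R) v : \sum_c K c * rho c v = K (cell v) * rho (cell v) v.
  rewrite (bigD1 (cell v)) //= big1 ?addr0 // => c cv.
  by rewrite rho_cell // mulr0.
have p0 : 0 <= p.
  have cI : (0 < #|I|%:R :> R).
    rewrite lt_neqAle ler0n andbT; apply: contra_eq_neq p_total => <-.
    by rewrite mul0r eq_sym oner_eq0.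
  by rewrite -(pmulr_rge0 _ cI) p_total.
have part (s : R) : `|s| = 1 -> exists2 q : R,
    (\int[P]_v (Num.max (s * X v) 0)%:E)%E = q%:E &
    `|q - (\sum_c Num.max (s * H c) 0) * p| <= e.
  move=> s1.
  pose Y v := Num.max (s * X v) 0.
  have Y0 v : 0 <= Y v by rewrite le_max lexx orbT.
  have HY v : `|s * X v - s * H (cell v) * rho (cell v) v| <= e * rho (cell v) v.
    by rewrite -mulrA -mulrBr normrM s1 mul1r.
  have up : (\int[P]_v (Y v)%:E <=
      ((\sum_c (Num.max (s * H c) 0 + e)) * p)%:E)%E.
    rewrite -(integral_cells rho0 mrho int_rho); last first.
      by move=> c; rewrite addr_ge0 // le_max lexx orbT.
    apply: ge0_le_integral_nonmeas => v; rewrite lee_fin // sum_cell.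
    rewrite mulrDl /Y ge_max; apply/andP; split; last first.
      by rewrite addr_ge0 // mulr_ge0 // le_max lexx orbT.
    have := HY v; rewrite ler_norml => /andP[_]; rewrite lerBlDr addrC => /le_trans.
    by apply; rewrite lerD2r ler_wpM2r // le_max lexx.
  have low : (((\sum_c (Num.max (Num.max (s * H c) 0 - e) 0)) * p)%:E <=
      \int[P]_v (Y v)%:E)%E.
    rewrite -(integral_cells rho0 mrho int_rho); last first.
      by move=> c; rewrite le_max lexx orbT.
    apply: ge0_le_integral_nonmeas => v; rewrite lee_fin sum_cell.
      by rewrite mulr_ge0 // le_max lexx orbT.
    have [|_] := ltP (Num.max (s * H (cell v)) 0 - e) 0; first by rewrite mul0r Y0.
    have := HY v; rewrite ler_norml => /andP[+ _].
    have [sH|sH] := ltP (s * H (cell v)) 0.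
      move=> _; rewrite (le_trans _ (Y0 v)) // mulr_le0_ge0 // sub0r oppr_le0 //.
    rewrite lerBrDr => K; rewrite /Y le_max; apply/orP; left.
    by apply: le_trans K; rewrite mulrBl addrC.
  have fin : (\int[P]_v (Y v)%:E)%E \is a fin_num.
    rewrite ge0_fin_numE; first exact: le_lt_trans up (ltry _).
    by apply: integral_ge0 => v _; rewrite lee_fin.
  exists (fine (\int[P]_v (Y v)%:E)%E); first by rewrite fineK.
  rewrite -(fineK fin) lee_fin in up; rewrite -(fineK fin) lee_fin in low.
  have ep : (\sum_(c : I) e) * p = e.
    by rewrite sumr_const -mulr_natl -mulrA mulrCA p_total mulr1.
  rewrite big_split /= mulrDl ep in up.
  have : (\sum_c (Num.max (s * H c) 0 - e)) * p <=
      (\sum_c Num.max (Num.max (s * H c) 0 - e) 0) * p.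
    by rewrite ler_wpM2r //; apply: ler_sum => c _; rewrite le_max lexx.
  rewrite sumrB mulrBl ep => low2.
  have low3 := le_trans low2 low.
  by rewrite ler_norml; apply/andP; split; [rewrite lerBrDr addrC|rewrite lerBlDr addrC].
have [q1 E1 B1] := part 1 (normr1 _).
have [q2 E2 B2] := part (-1) (normrN1 _).
have -> : fine ('E_P[X])%E = q1 - q2.
  rewrite unlock integralE.
  rewrite [X in (X - _)%E](_ : _ = q1%:E); last first.
    rewrite -E1; apply: eq_integral => v _; by rewrite funeposE /= mul1r EFin_max.
  rewrite [X in (_ - X)%E](_ : _ = q2%:E) // -E2.
  by apply: eq_integral => v _; rewrite funenegE /= mulN1r EFin_max EFinN.
have -> : \sum_c H c = \sum_c Num.max (1 * H c) 0 - \sum_c Num.max (-1 * H c) 0.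
  rewrite -sumrB; apply: eq_bigr => c _; rewrite mul1r mulN1r.
  have [h0|h0] := ltP (H c) 0.
    by rewrite max_l ?oppr_ge0 ?ltW // sub0r opprK.
  by rewrite max_r ?oppr_le0 // subr0.
rewrite mulrBl; move: B1 B2; rewrite !ler_norml; lra.
Qed.

End CellExpectation.

(** * The importance weights as a change of law *)

Section GaussianWeights.
Variable R : realType.

Let one0 : (1 : R) != 0. Proof. exact: oner_neq0. Qed.

Lemma normal_pdf_gt0 (x : R) : 0 < normal_pdf 0 1 x.
Proof.
rewrite normal_pdfE //= mulr_gt0 ?expR_gt0 //.
exact: normal_peak_gt0.
Qed.

Lemma phi_prod d (x : 'rV[R]_d) : phi x = \prod_j normal_pdf 0 1 (x 0 j).
Proof.
under eq_bigr do rewrite normal_pdfE //=.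
rewrite big_split /= /phi; congr (_ * _).
  rewrite prodr_const card_ord /normal_peak expr1n mul1r.
  have pi2 : (0 : R) <= 2 * pi by rewrite mulr_ge0 // pi_ge0.
  have -> : pi *+ 2 = 2 * pi :> R by rewrite mulr_natl.
  rewrite powRN exprVn; congr (_^-1).
  by rewrite (mulrC d%:R) powRrM powR12_sqrt // powR_mulrn // sqrtr_ge0.
rewrite /normal_fun -expR_sum enorm_sqr; congr expR.
rewrite mulr_suml -sumrN; apply: eq_bigr => j _.
by rewrite subr0 expr1n -mulNr.
Qed.

Section StandardNormal.
Context dW (TW : measurableType dW) (PW : probability TW R).
Variables (d : nat) (W : 'I_d -> {RV PW >-> R}).
Hypothesis hW : standard_normal_vector W.

Lemma integral_standard_normal j (v : R -> R) : measurable_fun setT v ->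
  (forall x, 0 <= v x) ->
  (\int[PW]_w (v (W j w))%:E =
   \int[lebesgue_measure]_x (normal_pdf 0 1 x * v x)%:E)%E.
Proof.
move=> mv v0.
have mvE : measurable_fun setT (fun x => (v x)%:E) by exact/measurable_EFinP.
have vE0 x : (0 <= (v x)%:E)%E by rewrite lee_fin.
transitivity (\int[distribution PW (W j)]_y (v y)%:E)%E.
  by rewrite ge0_integral_distribution.
have H A : measurable A ->
    (\int[lebesgue_measure]_x ((normal_pdf 0 1 x)%:E * (\1_A (id x))%:E) =
     1%:E * distribution PW (W j) A)%E.
  move=> mA; rewrite mul1e hW.2 // /normal_prob [RHS]integral_mkcond.
  by apply: eq_integral => x _; rewrite epatch_indic.
have := @weighted_integral _ _ R lebesgue_measure id (@measurable_id _ _ setT)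
  (normal_pdf 0 1) (distribution PW (W j)) 1 (normal_pdf_ge0 0 1)
  (measurable_normal_pdf 0 1) H _ mvE vE0.
rewrite mul1e => <-; apply: eq_integral => x _; by rewrite EFinM.
Qed.

(** The weight g_j / phi turns a standard normal variable into tau_j. *)
Lemma integral_weight_cell (D : density_vector R d) j (A : set R) : measurable A ->
  (\int[PW]_w (g D j (W j w) / normal_pdf 0 1 (W j w) * \1_A (W j w))%:E =
   \int[lebesgue_measure]_(x in A) (g D j x)%:E)%E.
Proof.
move=> mA.
rewrite (@integral_standard_normal j (fun x => g D j x / normal_pdf 0 1 x * \1_A x)).
- rewrite [RHS]integral_mkcond; apply: eq_integral => x _.
  rewrite epatch_indic /= -EFinM; congr EFin.
  by rewrite mulrA (mulrC (g D j x)) mulVKf // gt_eqF // normal_pdf_gt0.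
- apply: measurable_funM; last exact: measurable_indic.
  apply: measurable_funM; first exact: g_measurable.
  apply: continuous_measurable_fun => x; apply: cvgV.
    by rewrite gt_eqF // normal_pdf_gt0.
  exact: continuous_normal_pdf.
- move=> x; rewrite !mulr_ge0 ?g_ge0 //.
  by rewrite invr_ge0 normal_pdf_ge0.
Qed.

End StandardNormal.
End GaussianWeights.

(** * The integrand on cells *)

Section Pair.
Variables (R : realType) (d b N : nat).
Hypothesis hb : (1 < b)%N.
Hypothesis hd : (0 < d)%N.
Variables (M B : R) (h : 'rV[R]_d -> R) (D : density_vector R d).
Hypothesis hM : 0 < M < 1 / 2.
Hypothesis hq : Ge2 M B (h_over_g h D).
Variable L : R -> R.
Hypothesis gL : forall (j : 'I_d) (r x : R), `|x| <= r ->
  0 < g D j x /\ (g D j x)^-1 <= L r.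
Variable r : R.
Hypothesis r0 : 0 <= r.

Local Notation column := {ffun 'I_N -> 'I_b}.
Local Notation cells := {ffun 'I_d -> {ffun 'I_N -> 'I_b}}.
Local Notation levels := {ffun 'I_d -> 'I_N.+1}.

Let f (x : 'rV[R]_d) := phi x * h_over_g h D x.
Definition clipped_point (y : 'I_d -> R) : 'rV[R]_d :=
  \row_j clipped_quantile D j r (y j).
Definition cell_value (c : cells) : R :=
  f (clipped_point (fun j => cell_left R (c j))).

Definition sup_const : R := gauss_const R d * B.
Definition deriv_bound : R := sup_const * deriv_const M ^+ d.
Definition tail_error : R := 2 * sup_const * expR (- ((1 / 2 - M) * r ^+ 2)).
Definition cell_error : R := deriv_bound * (d%:R * (L r * b%:R ^- N)).

Let bp : (0 : R) < b%:R.
Proof. by rewrite ltr0n ltnW. Qed.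

Let Lr0 : 0 <= L r.
Proof.
have [|g0] := gL (Ordinal hd) (r := r) (x := 0); first by rewrite normr0.
by apply: le_trans; rewrite invr_ge0 ltW.
Qed.

Lemma sup_const_ge0 : 0 <= sup_const.
Proof. by rewrite mulr_ge0 ?gauss_const_ge0 // (growth_const_ge0 hq). Qed.

Lemma deriv_bound_ge0 : 0 <= deriv_bound.
Proof.
by rewrite mulr_ge0 ?sup_const_ge0 // exprn_ge0 // (le_trans ler01) // deriv_const_ge1.
Qed.

Let alpha0 : 0 < 1 / 2 - M.
Proof. by case/andP: hM => _; rewrite subr_gt0. Qed.

Lemma integrand_sup x : `|f x| <= sup_const.
Proof.
rewrite (le_trans (gauss_mul_bound hq x)) // -[leRHS]mulr1 ler_wpM2l ?sup_const_ge0 //.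
by rewrite -[leRHS]expR0 ler_expR oppr_le0 mulr_ge0 ?sqr_ge0 // ltW.
Qed.

Lemma integrand_tail (x : 'rV[R]_d) j : r <= `|x 0 j| -> `|f x| <= tail_error / 2.
Proof.
move=> rx; rewrite (le_trans (gauss_mul_bound hq x)) //.
have -> : tail_error / 2 = sup_const * expR (- ((1 / 2 - M) * r ^+ 2)).
  by rewrite /tail_error; field.
rewrite ler_wpM2l ?sup_const_ge0 // ler_expR lerN2 ler_wpM2l ?(ltW alpha0) //.
rewrite enorm_sqr (bigD1 j) //= -[leLHS]addr0; apply: lerD.
  by rewrite -[leRHS]real_normK ?num_real // lerXn2r // nnegrE.
by apply: sumr_ge0 => i _; exact: sqr_ge0.
Qed.

Lemma tail_error_ge0 : 0 <= tail_error.
Proof. by rewrite mulr_ge0 ?expR_ge0 // mulr_ge0 // sup_const_ge0. Qed.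

Lemma cell_error_ge0 : 0 <= cell_error.
Proof.
by rewrite mulr_ge0 ?deriv_bound_ge0 // mulr_ge0 // mulr_ge0 // invr_ge0.
Qed.

(** Either x = y, or both points have a coordinate of modulus at least r and f is
    small at each of them. *)
Lemma integrand_clip (x y : 'rV[R]_d) :
  (forall j, y 0 j = x 0 j \/ (r <= `|x 0 j| /\ r <= `|y 0 j|)) ->
  `|f x - f y| <= tail_error.
Proof.
move=> xy.
have [E|/existsNP[j /eqP xj]] := pselect (forall j, y 0 j = x 0 j).
  rewrite (_ : y = x) ?subrr ?normr0 ?tail_error_ge0 //.
  by apply/rowP => j; exact: E.
have [/eqP|[rx ry]] := xy j; first by rewrite (negPf xj).
rewrite (le_trans (ler_normB _ _)) // [leRHS]splitr.
by apply: lerD; apply: integrand_tail; [exact: rx|exact: ry].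
Qed.

Lemma integrand_cell (c : cells) (y : 'I_d -> R) :
  (forall j, `|y j - cell_left R (c j)| <= b%:R ^- N) ->
  `|f (clipped_point y) - cell_value c| <= cell_error.
Proof.
move=> yc.
have subseq1 j : subseq [:: j] (enum 'I_d) by rewrite sub1seq mem_enum.
apply: (le_trans (lipschitz_partials (K0 := deriv_bound) _ _ _ _)).
- by move=> j x; exact: (gauss_mul_derivable hq (subseq1 j)).
- by move=> j x; exact: (gauss_mul_mixed_bound hM hq _ (subseq1 j)).
rewrite ler_wpM2l ?deriv_bound_ge0 // -[X in X%:R * _]card_ord -sum1_card.
rewrite natr_sum mulr_suml; apply: ler_sum => j _; rewrite mul1r !mxE.
rewrite (le_trans (clipped_quantile_lip (gL j) r0 _ _)) //.
by rewrite ler_wpM2l.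
Qed.

(** Coordinate j with k j > 0 carries a signed weight supported by the columns that
    share k j - 1 digits with y j; their clipped quantiles are within
    Lam b^(1 - k j) of each other. *)
Lemma haar_component_cell_value (Lam : R) (k : levels) (y : cells) :
  1 <= Lam -> L r <= Lam ->
  `|haar_component cell_value (fun j => k j) y| <=
    deriv_bound * (2 * b%:R * Lam) ^+ d / b%:R ^+ (\sum_j k j).
Proof.
move=> Lam1 LLam.
have Lam0 : 0 <= Lam := le_trans ler01 Lam1.
have kN (k' : levels) j : (k' j <= N)%N by rewrite -ltnS.
have T := @tensor_bound R d column (fun j c => haar_kernel R (k j) (y j) c)
  (fun j c => clipped_quantile D j r (cell_left R c)) f deriv_bound _ _
  (fun j => (0 < k j)%N) (fun j => Lam / b%:R ^+ (k j).-1)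
  (fun j => clipped_quantile D j r (cell_left R (y j))).
have E : haar_component cell_value (fun j => k j) y = \sum_(c : cells)
    f (\row_i clipped_quantile D i r (cell_left R (c i))) *
    \prod_j haar_kernel R (k j) (y j) (c j).
  by apply: eq_bigr => c _.
rewrite E; apply: le_trans (T _ _ _ _ _ _ _) _.
- by move=> j s sE x; exact: (gauss_mul_derivable hq sE).
- by move=> s sE x; exact: (gauss_mul_mixed_bound hM hq _ sE).
- move=> j; rewrite -leqNgt leqn0 => /eqP ->.
  by under eq_bigr do rewrite ger0_norm ?avg_kernel_ge0 //; rewrite sum_avg_kernel.
- by move=> j _; exact: sum_haar_kernel_norm.
- by move=> j kj; rewrite sum_haar_kernel // kj kN.
- move=> j c kj /haar_kernel_support; rewrite agree_sym => yc.
  rewrite (le_trans (clipped_quantile_lip (gL j) r0 _ _)) //.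
  apply: ler_pM => //.
  apply: cell_left_agree => //.
  by rewrite (leq_trans (leq_pred _)).
- by move=> j; rewrite divr_ge0 // exprn_ge0 // ltW.
rewrite -mulrA ler_wpM2l ?deriv_bound_ge0 //.
rewrite -[X in _ ^+ X]card_ord -prodr_const -prodrXr -prodfV -big_split /=.
apply: ler_prod => j _; apply/andP; split.
  by case: ifP => // _; rewrite mulr_ge0 // divr_ge0 // exprn_ge0 // ltW.
case: (val (k j)) => [|l] /=.
  rewrite expr0 divr1 -[leLHS]mulr1; apply: ler_pM => //.
  by have := ler1n R (2 * b); rewrite natrM => ->; rewrite muln_gt0 /= ltnW.
rewrite exprS le_eqVlt; apply/orP; left; apply/eqP; field.
by rewrite expf_neq0 ?gt_eqF // (gt_eqF bp).
Qed.

Lemma cell_value_sup c : `|cell_value c| <= sup_const.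
Proof. exact: integrand_sup. Qed.

Section Mean.
Context dW (TW : measurableType dW) (PW : probability TW R).
Variable W : 'I_d -> {RV PW >-> R}.
Hypothesis hW : standard_normal_vector W.

Lemma g_gt0 j x : 0 < g D j x.
Proof. by have [] := gL j (lexx `|x|). Qed.

Lemma joint_density_gt0 x : 0 < joint_density D x.
Proof. by apply: prodr_gt0 => j _; exact: g_gt0. Qed.

(** With the weight prod_j g_j(W_j) / phi(W_j), the cell of (F_j(W_j))_j is
    uniformly distributed and h(W) becomes f(W), which is close to the value of f
    at that cell. *)
Lemma mean_cell_value :
  `|fine ('E_PW[fun v => h (rvec W v)])%E - cell_mean cell_value| <=
    2 * (tail_error + cell_error).
Proof.
pose A (c : cells) j : set R := [set x | column_of hb N (rcdf D j x) == c j].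
have F01 j x : 0 <= rcdf D j x < 1 by rewrite rcdf_ge0 (rcdf_lt1 (gL j)).
have AE c j : A c j = [set x | cell_left R (c j) <= rcdf D j x <
    cell_left R (c j) + b%:R ^- N].
  by apply/funext => x; rewrite /A /= column_ofE.
have mA c j : measurable (A c j).
  rewrite AE (_ : [set x | _] = [set x | rcdf D j x < cell_left R (c j) + b%:R ^- N] `\`
     [set x | rcdf D j x < cell_left R (c j)]).
    by apply: measurableD; exact: measurable_rcdf_lt.
  apply/seteqP; split => x /=.
    by move=> /andP[xy ->]; split => //; apply/negP; rewrite -leNgt.
  by move=> [-> /negP]; rewrite -leNgt => ->.
pose rho (c : cells) v := \prod_j
  (g D j (W j v) / normal_pdf 0 1 (W j v) * \1_(A c j) (W j v)).
pose p : R := \prod_(j < d) b%:R ^- N.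
have term_ge0 c j x : 0 <= g D j x / normal_pdf 0 1 x * \1_(A c j) x.
  by rewrite !mulr_ge0 ?g_ge0 // invr_ge0 normal_pdf_ge0.
have mterm c j : measurable_fun setT
    (fun x => g D j x / normal_pdf 0 1 x * \1_(A c j) x).
  apply: measurable_funM; last exact: measurable_indic.
  apply: measurable_funM; first exact: g_measurable.
  apply: continuous_measurable_fun => x; apply: cvgV.
    by rewrite gt_eqF // normal_pdf_gt0.
  apply: continuous_normal_pdf; exact: oner_neq0.
have rho0 c v : 0 <= rho c v by apply: prodr_ge0.
have mrho c : measurable_fun setT (rho c).
  apply: measurable_fun_prod_seq => j.
  exact: (measurableT_comp (mterm c j)).
have int_rho c : (\int[PW]_v (rho c v)%:E)%E = p%:E.
  apply: (integral_prod_indep hW.1 (u := fun j x => g D j x / normal_pdf 0 1 x *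
     \1_(A c j) x)) => // j.
  rewrite (integral_weight_cell hW) // AE (integral_density_cell (gL j)) //.
  - by rewrite addrC addKr.
  - exact: cell_left_ge0.
  - by rewrite lerDl invr_ge0 exprn_ge0 // ltW.
  - exact: cell_right_le1.
have pE : p = #|cells|%:R^-1.
  by rewrite card_cells // /p prodr_const card_ord exprVn.
pose cell v : cells := [ffun j => column_of hb N (rcdf D j (W j v))].
have rho_cell c v : c != cell v -> rho c v = 0.
  move=> cv; have [j cj] : exists j, c j != cell v j.
    apply/existsP; apply: contraNT cv; rewrite negb_exists => /forallP E.
    by apply/eqP/ffunP => j; apply/eqP; have := E j; rewrite negbK.
  rewrite /rho (bigD1 j) //= indicE memNset ?mulr0 ?mul0r //.
  by rewrite /A /=; move: cj; rewrite ffunE eq_sym => /negPf ->.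
have p_total : #|{: cells}|%:R * p = 1.
  by rewrite pE divff // card_cells // !expf_neq0 // gt_eqF.
have eE : 0 <= tail_error + cell_error.
  exact: addr_ge0 tail_error_ge0 cell_error_ge0.
rewrite /cell_mean -pE; apply: (expectation_cells rho0 mrho int_rho p_total rho_cell) => // v.
have hE : h (rvec W v) = f (rvec W v) * rho (cell v) v.
  have rE : rho (cell v) v = joint_density D (rvec W v) / phi (rvec W v).
    rewrite phi_prod /joint_density -prodf_div; apply: eq_bigr => j _.
    by rewrite !mxE indicE mem_set ?mulr1 // /A /= ffunE.
  have jd0 : joint_density D (rvec W v) != 0 by rewrite gt_eqF ?joint_density_gt0.
  have ph0 : phi (rvec W v) != 0.
    by rewrite phi_prod; apply/prodf_neq0 => j _; rewrite gt_eqF // normal_pdf_gt0.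
  by rewrite rE /f /h_over_g; field; rewrite jd0 ph0.
rewrite hE -mulrBl normrM (ger0_norm (rho0 _ _)) ler_wpM2r //.
pose y j := rcdf D j (W j v).
apply: (le_trans (ler_distD (f (clipped_point y)) _ _)); apply: lerD.
  apply: integrand_clip => j; rewrite !mxE.
  by have [] := clipped_quantile_rcdf (gL j) r0 (W j v); [left|right].
apply: integrand_cell => j.
have := column_ofE hb (cell v j) (F01 j (W j v)); rewrite ffunE eqxx => /esym.
move=> /andP[y1 y2]; rewrite ger0_norm ?subr_ge0 // lerBlDl.
exact: ltW.
Qed.

End Mean.

End Pair.

(** * The law of the permutations and the digits of a net *)

Section RandomFamily.
Variables (R : realType) (d b N : nat).
Hypothesis hb : (1 < b)%N.
Context dT (T : measurableType dT) (P : probability T R).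
Variable perms : 'I_d * seq 'I_b -> T -> 'S_b.
Hypothesis hperms : uniform_permutations P perms.

Local Notation keys := ('I_d * N.-bseq 'I_b)%type.
Local Notation family := {ffun 'I_d * N.-bseq 'I_b -> 'S_b}.
Local Notation cells := {ffun 'I_d -> {ffun 'I_N -> 'I_b}}.

Definition family_of (w : T) : family :=
  [ffun q : keys => perms (q.1, q.2 : seq 'I_b) w].

Let event (f : family) : set T := [set w | family_of w = f].

Let key_of (q : keys) : 'I_d * seq 'I_b := (q.1, q.2 : seq 'I_b).
Let key_of_inj : injective key_of.
Proof. by move=> [j s] [j' s'] [-> /val_inj ->]. Qed.

Let key_ofK (q : keys) : ((key_of q).1, insub_bseq N (key_of q).2) = q.
Proof.
case: q => j q; congr (_, _); apply: val_inj.
by rewrite /insub_bseq val_insubd /=; case: ifP => //; have -> := size_bseq q.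
Qed.

Let eventE f : event f =
  \big[setI/setT]_(q <- [seq key_of q | q <- enum (keys : finType)])
    (perms q @^-1` [set f (q.1, insub_bseq N q.2)]).
Proof.
have H (s : seq keys) : \big[setI/setT]_(q <- [seq key_of q | q <- s])
    (perms q @^-1` [set f (q.1, insub_bseq N q.2)]) =
    [set w | forall q, q \in s -> family_of w q = f q].
  elim: s => [|q s IH] /=.
    by rewrite big_nil; apply/seteqP; split.
  rewrite big_cons IH; apply/seteqP; split => w /=.
    move=> [E Es] q'; rewrite inE => /predU1P[->|]; last exact: Es.
    by rewrite ffunE E key_ofK.
  move=> E; split; last by move=> q' q's; apply: E; rewrite inE q's orbT.
  by have := E q (mem_head _ _); rewrite ffunE key_ofK.
rewrite H; apply/seteqP; split => w /=; first by move=> <-.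
by move=> E; apply/ffunP => q; apply: E; rewrite mem_enum.
Qed.

Let mevent f : measurable (event f).
Proof.
have [mP _ _] := hperms.
by rewrite eventE; apply: bigsetI_measurable => q _; exact: mP.
Qed.

Let Pevent f : P (event f) = (#|{: family}|%:R^-1)%:E.
Proof.
have [_ uP iP] := hperms.
rewrite eventE iP //; last by rewrite (map_inj_uniq key_of_inj) enum_uniq.
under eq_bigr do rewrite uP.
rewrite prodEFin big_map big_enum /= prodr_const card_ffun card_Sn.
by rewrite natrX exprVn.
Qed.

(** The finite family of permutations is uniform, by independence of the
    permutations at distinct keys. *)
Lemma integral_family (Z : family -> R) : (forall f, 0 <= Z f) ->
  (\int[P]_w (Z (family_of w))%:E)%E = ((\sum_f Z f) / #|{: family}|%:R)%:E.
Proof.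
move=> Z0.
rewrite -(@integral_cells _ _ _ P _ (fun f w => \1_(event f) w)) //.
- apply: eq_integral => w _; rewrite (bigD1 (family_of w)) //= big1 ?addr0.
    by rewrite indicE mem_set ?mulr1.
  by move=> f fw; rewrite indicE memNset ?mulr0 // => /esym/eqP; rewrite (negPf fw).
- by move=> f; exact: measurable_indic.
- by move=> f; rewrite integral_indic // setIT; exact: Pevent.
Qed.

End RandomFamily.

Section NetCells.
Variables (R : realType) (d b lam t m N : nat).
Hypothesis hb : (1 < b)%N.
Variable x : 'I_(lam * b ^ m) -> 'rV[R]_d.
Hypothesis hx : is_net t x.
Hypothesis mN : (m <= N)%N.

Local Notation cells := {ffun 'I_d -> {ffun 'I_N -> 'I_b}}.

Definition net_cell (i : 'I_(lam * b ^ m)) : cells :=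
  [ffun j => column_of hb N (x i 0 j)].

(** The cells of k leading digits are the elementary intervals of shape k. *)
Lemma net_cell_count (k : 'I_d -> nat) : (\sum_j k j = m - t)%N ->
  forall c : cells, #|[pred i | cells_agree k (net_cell i) c]| = (lam * b ^ t)%N.
Proof.
have [tm x01 hcount _] := hx.
move=> sk c.
have b0 : (0 : R) < b%:R by rewrite ltr0n ltnW.
have kN j : (k j <= N)%N.
  apply: (@leq_trans (\sum_j k j)); first by rewrite (bigD1 j) //= leq_addr.
  by rewrite sk (leq_trans (leq_subr _ _)).
rewrite -(hcount k (fun j => cell_index (k j) (c j))); last 2 first.
- by move=> j; exact: cell_index_lt.
- rewrite /elementary_volume prodfV prodrXr sk -[in RHS]opprB subzn //.
  by rewrite -exprnN.
apply: eq_card => i; rewrite !inE; apply/forallP/forallP => H j; have := H j.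
  rewrite ffunE -cell_index_agree // cell_index_column_of //.
  have /andP[xij0 _] := x01 i j.
  rewrite ler_pdivrMr ?ltr_pdivlMr ?exprn_gt0 // => /eqP <-.
  by rewrite truncn_itv // mulr_ge0 // exprn_ge0 // ltW.
have /andP[xij0 _] := x01 i j.
rewrite ffunE -cell_index_agree // cell_index_column_of //.
rewrite ler_pdivrMr ?ltr_pdivlMr ?exprn_gt0 // => H'.
by apply/eqP/truncn_def.
Qed.

End NetCells.

(** * The mean squared error for one integrand *)

Section PairMSE.
Variables (R : realType) (d b lam t m N : nat).
Hypothesis hb : (1 < b)%N.
Hypothesis hd : (0 < d)%N.
Hypothesis hlam : (0 < lam)%N.
Hypothesis mN : (m <= N)%N.
Variables (M B : R) (h : 'rV[R]_d -> R) (D : density_vector R d).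
Hypothesis hM : 0 < M < 1 / 2.
Hypothesis hq : Ge2 M B (h_over_g h D).
Variable L : R -> R.
Hypothesis gL : forall (j : 'I_d) (r x : R), `|x| <= r ->
  0 < g D j x /\ (g D j x)^-1 <= L r.
Variable r : R.
Hypothesis r0 : 0 <= r.
Variable x : 'I_(lam * b ^ m) -> 'rV[R]_d.
Hypothesis hx : is_net t x.
Context dT (T : measurableType dT) (P : probability T R).
Variable perms : 'I_d * seq 'I_b -> T -> 'S_b.
Hypothesis hperms : uniform_permutations P perms.
Context dW (TW : measurableType dW) (PW : probability TW R).
Variable W : 'I_d -> {RV PW >-> R}.
Hypothesis hW : standard_normal_vector W.

Local Notation family := {ffun 'I_d * N.-bseq 'I_b -> 'S_b}.
Local Notation cells := {ffun 'I_d -> {ffun 'I_N -> 'I_b}}.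

Let n : R := (lam * b ^ m)%:R.
Let n0 : 0 < n.
Proof. by rewrite ltr0n muln_gt0 hlam expn_gt0 ltnW. Qed.
Let bp : (0 : R) < b%:R.
Proof. by rewrite ltr0n ltnW. Qed.
Let f (y : 'rV[R]_d) := phi y * h_over_g h D y.
Let H := cell_value (b := b) (N := N) h D r.
Let C0 := sup_const d B.
Let delta := tail_error d M B r + cell_error d b N M B L r.
Let a := net_cell N hb x.
Let y (w : T) i := scramble hb (fun js => perms js w) (x i).
Let mean := fine ('E_PW[fun v => h (rvec W v)])%E.

(** At 0 and 1 the quantile function takes a conventional value.  Outside these
    cells a scrambled coordinate is strictly between 0 and 1. *)
Definition boundary_cell (c : cells) : bool :=
  [exists j, (cell_index N (c j) == 0%N) || (cell_index N (c j) == (b ^ N).-1)].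

Lemma scramble_cells_family_of w i j :
  scramble_cells (family_of N perms w) (a i) j =
  scramble_column hb N (fun s => perms (j, s) w) (x i 0 j).
Proof.
apply/ffunP => l; rewrite !ffunE /= val_key ?(ltnW (ltn_ord l)) //.
Qed.

Lemma scramble_in_cell w i j :
  cell_left R (scramble_cells (family_of N perms w) (a i) j) <= y w i 0 j <=
  cell_left R (scramble_cells (family_of N perms w) (a i) j) + b%:R ^- N.
Proof. by rewrite scramble_cells_family_of /y mxE; exact: scramble_coord_near. Qed.

Lemma estimator_cell w i : ~~ boundary_cell (scramble_cells (family_of N perms w) (a i)) ->
  `|hIS h D (Finv D (y w i)) - H (scramble_cells (family_of N perms w) (a i))| <= delta.
Proof.
set c := scramble_cells _ _ => nb.
have yc j : `|y w i 0 j - cell_left R (c j)| <= b%:R ^- N.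
  have /andP[y1 y2] := scramble_in_cell w i j.
  by rewrite ger0_norm ?subr_ge0 // lerBlDl.
have bN : (0 : R) < b%:R ^+ N by rewrite exprn_gt0.
have y01 j : 0 < y w i 0 j < 1.
  have /andP[y1 y2] := scramble_in_cell w i j.
  move: nb; rewrite negb_exists => /forallP /(_ j); rewrite negb_or => /andP[c0 c1].
  apply/andP; split.
    by apply: lt_le_trans y1; rewrite divr_gt0 // ltr0n lt0n.
  apply: le_lt_trans y2 _; rewrite -/c /cell_left -[X in _ + X]mul1r -mulrDl.
  rewrite ltr_pdivrMr // mul1r natr1 -natrX ltr_nat.
  have : (cell_index N (c j) < b ^ N)%N by exact: cell_index_lt.
  rewrite leq_eqVlt => /predU1P[E|//].
  by move: c1; rewrite -E eqxx.
have -> : hIS h D (Finv D (y w i)) = f (Finv D (y w i)).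
  by rewrite /hIS /f /h_over_g mulrA.
apply: (le_trans (ler_distD (f (clipped_point D r (fun j => y w i 0 j))) _ _)).
apply: lerD; last exact: (integrand_cell hd hM hq gL r0 yc).
apply: (integrand_clip hM hq r0) => j.
have -> : Finv D (y w i) 0 j = quantile D j (y w i 0 j) by rewrite mxE.
have -> : clipped_point D r (fun j => y w i 0 j) 0 j =
    clipped_quantile D j r (y w i 0 j) by rewrite mxE.
by have [->|[r1 r2]] := quantile_clip (gL j) r0 (y01 j); [left|right].
Qed.

Let ave (F : 'I_(lam * b ^ m) -> R) := n^-1 * \sum_i F i.

Let ave_bound F (K : R) : (forall i, `|F i| <= K) -> `|ave F| <= K.
Proof.
move=> FK; rewrite /ave normrM ger0_norm ?invr_ge0 ?(ltW n0) //.
rewrite ler_pdivrMl //; apply: le_trans (ler_norm_sum _ _ _) _.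
rewrite /n mulr_natl -[X in _ *+ X]card_ord -sumr_const.
by apply: ler_sum => i _.
Qed.

Let aveB F G : ave F - ave G = ave (fun i => F i - G i).
Proof. by rewrite /ave -mulrBr -sumrB. Qed.

Let Z (w : family) : R :=
  2 * (ave (fun i => H (scramble_cells w (a i))) - cell_mean H) ^+ 2 + 18 * delta ^+ 2 +
  8 * C0 ^+ 2 * \sum_i (boundary_cell (scramble_cells w (a i)))%:R.

Let delta0 : 0 <= delta.
Proof.
by apply: addr_ge0; [exact: (tail_error_ge0 hq r)|exact: (cell_error_ge0 b N hd hM hq gL r0)].
Qed.

Let C00 : 0 <= C0. Proof. exact: (sup_const_ge0 hq). Qed.

Let cmeanH : `|mean - cell_mean H| <= 2 * delta.
Proof. exact: (mean_cell_value N hb hd hM hq gL r0 hW). Qed.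

Let Z0 w : 0 <= Z w.
Proof.
apply: addr_ge0; first by apply: addr_ge0; rewrite mulr_ge0 ?sqr_ge0.
by apply: mulr_ge0; [rewrite mulr_ge0 ?sqr_ge0|exact: sumr_ge0].
Qed.

(** Away from boundary cells the estimator is within delta of the average of H and
    E[h(W)] is within 2 delta of the mean of H.  On boundary cells f is only
    known to be bounded, which suffices since they are improbable. *)
Lemma squared_error_le w :
  (IS_estimator h D (y w) - mean) ^+ 2 <= Z (family_of N perms w).
Proof.
set w' := family_of N perms w.
have -> : IS_estimator h D (y w) = ave (fun i => hIS h D (Finv D (y w i))) by [].
set e := ave (fun i => hIS h D (Finv D (y w i))).
rewrite /Z; set e' := ave _; set s := \sum_i _.
have s0 : 0 <= s by apply: sumr_ge0.
have sqr_le (u v : R) : `|u| <= v -> u ^+ 2 <= v ^+ 2.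
  move=> uv; rewrite -(real_normK (num_real u)) lerXn2r ?nnegrE //.
  exact: le_trans uv.
have := cmeanH; set mu := cell_mean H => mm.
have [/existsP[i bi]|] := boolP [exists i, boundary_cell (scramble_cells w' (a i))].
  have s1 : 1 <= s.
    rewrite /s (bigD1 i) //= bi lerDl; exact: sumr_ge0.
  have eC : `|e| <= C0.
    by apply: ave_bound => k; rewrite /hIS -mulrA; exact: (integrand_sup hM hq).
  have mC : `|mu| <= C0.
    rewrite /mu /cell_mean normrM normfV normr_nat.
    rewrite ler_pdivrMr; last first.
      by rewrite card_cells // !exprn_gt0.
    rewrite (le_trans (ler_norm_sum _ _ _)) // mulr_natr -sumr_const.
    by apply: ler_sum => c _; exact: (cell_value_sup hM hq).
  have em : `|e - mean| <= 2 * C0 + 2 * delta.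
    have := ler_normB e mean; have := ler_normD (mean - mu) mu; rewrite subrK; lra.
  have sq := sqr_le _ _ em.
  have : 8 * C0 ^+ 2 <= 8 * C0 ^+ 2 * s.
    by rewrite ler_peMr // mulr_ge0 // sqr_ge0.
  have := sqr_ge0 (e' - mu); have := sqr_ge0 (C0 - delta).
  have := sqr_ge0 delta; nra.
rewrite negb_exists => /forallP nb.
have ee : `|e - e'| <= delta.
  by rewrite /e /e' aveB; apply: ave_bound => i; exact: estimator_cell.
have em : `|(e - mean) - (e' - mu)| <= 3 * delta.
  have -> : (e - mean) - (e' - mu) = (e - e') - (mean - mu) by ring.
  by have := ler_normB (e - e') (mean - mu); lra.
have sq := sqr_le _ _ em.
have : 0 <= 8 * C0 ^+ 2 * s by rewrite mulr_ge0 // mulr_ge0 // sqr_ge0.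
have := sqr_ge0 (2 * (e' - mu) - (e - mean)); nra.
Qed.

(** Each scrambled point is uniform over the cells, and only two of the b^N columns
    in each coordinate are at the boundary. *)
Lemma boundary_mean i :
  \sum_(w : family) (boundary_cell (scramble_cells w (a i)))%:R <=
    #|{: family}|%:R * (2 * d%:R * b%:R ^- N) :> R.
Proof.
pose c0 : cells := [ffun=> [ffun=> Ordinal (ltnW hb)]].
have one v j : cell_mean (fun c : cells => (cell_index N (c j) == v)%:R : R) <=
    b%:R ^- N.
  have [/existsP[z /eqP zv]|nz] := boolP [exists z : {ffun 'I_N -> 'I_b}, cell_index N z == v].
    pose k (i : 'I_d) := if i == j then N else 0%N.
    rewrite (_ : b%:R ^- N = b%:R ^- (\sum_j k j)); last first.
      rewrite (bigD1 j) //= big1 ?addn0 /k ?eqxx // => i' /negPf -> //.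
    rewrite -(cell_mean_agree R hb (k := k) [ffun=> z]) => [|i']; last by rewrite /k; case: ifP.
    rewrite /cell_mean ler_wpM2r ?invr_ge0 //; apply: ler_sum => c _; rewrite ler_nat.
    case: eqP => // E; rewrite (_ : cells_agree _ _ _) //.
    apply/cells_agreeP => i'; rewrite ffunE /k; case: eqP => [->|_]; last exact: agree0.
    by rewrite -cell_index_agree // zv E.
  rewrite /cell_mean big1 ?mul0r ?invr_ge0 ?exprn_ge0 ?(ltW bp) // => c _.
  case: eqP => // E; case/negP: nz; apply/existsP; exists (c j); exact/eqP.
rewrite (scrambled_cell_uniform hb (fun c => (boundary_cell c)%:R : R)) ler_wpM2l //.
apply: (@le_trans _ _ (cell_mean (fun c : cells => \sum_j
    ((cell_index N (c j) == 0%N)%:R + (cell_index N (c j) == (b ^ N).-1)%:R) : R))).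
  rewrite /cell_mean ler_wpM2r ?invr_ge0 //; apply: ler_sum => c _.
  have [/existsP[j bj]|_] := boolP (boundary_cell c); last first.
    by apply: sumr_ge0 => j _; rewrite addr_ge0.
  rewrite (bigD1 j) //= (le_trans (y := (cell_index N (c j) == 0%N)%:R +
      (cell_index N (c j) == (b ^ N).-1)%:R)) //; last first.
    by rewrite lerDl sumr_ge0 // => k _; rewrite addr_ge0.
  by case/orP: bj => ->; rewrite ?lerDl ?lerDr.
rewrite {1}/cell_mean exchange_big /= mulr_suml.
apply: (@le_trans _ _ (\sum_(j < d) (2 * b%:R ^- N))); last first.
  rewrite sumr_const card_ord -[leLHS]mulr_natl; lra.
apply: ler_sum => j _; rewrite big_split /= mulrDl.
have := one 0%N j; have := one (b ^ N).-1 j; rewrite /cell_mean; lra.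
Qed.

Variable Lam : R.
Hypothesis Lam1 : 1 <= Lam.
Hypothesis LLam : L r <= Lam.
Let beta := deriv_bound d M B * (2 * b%:R * Lam) ^+ d.

Lemma pair_mse :
  (scrambled_mse hb P perms x W h D <=
   (2 * (N.+1%:R ^+ d * (lam * b ^ (t + d))%:R / n *
      (beta / b%:R ^+ (m - t)) ^+ 2) +
    18 * delta ^+ 2 + 8 * C0 ^+ 2 * (n * (2 * d%:R * b%:R ^- N)))%:E)%E.
Proof.
have F0 : (0 : R) < #|{: family}|%:R.
  by rewrite lt_neqAle ler0n andbT eq_sym card_family_neq0.
have E (X : T -> R) : ('E_P[X] = \int[P]_w (X w)%:E)%E by rewrite unlock.
rewrite /scrambled_mse E.
apply: (@le_trans _ _ (\int[P]_w (Z (family_of N perms w))%:E)%E).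
  apply: ge0_le_integral_nonmeas => w; rewrite lee_fin ?sqr_ge0 //.
  exact: squared_error_le.
rewrite (integral_family hperms) // lee_fin ler_pdivrMr //.
rewrite /Z !big_split /= -!mulr_sumr.
have [tm _ _ _] := hx.
have V := @net_variance R d b N lam t m hb hd hlam _ a _ H beta _.
have {}V : \sum_(w : family) (ave (fun i => H (scramble_cells w (a i))) - cell_mean H) ^+ 2 <=
    #|{: family}|%:R * (N.+1%:R ^+ d * (lam * b ^ (t + d))%:R / n *
      (beta / b%:R ^+ (m - t)) ^+ 2).
  apply: V; first by rewrite tm.
    by move=> k sk c; exact: net_cell_count.
  move=> k c; exact: (haar_component_cell_value hb hd hM hq gL r0).
have Bd : \sum_(w : family) \sum_i (boundary_cell (scramble_cells w (a i)))%:R <=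
    n * (#|{: family}|%:R * (2 * d%:R * b%:R ^- N)) :> R.
  rewrite exchange_big /= /n mulr_natl -[X in _ *+ X]card_ord -sumr_const.
  by apply: ler_sum => i _; exact: boundary_mean.
have V2 := ler_wpM2l (ler0n R 2) V.
have Bd2 : 8 * C0 ^+ 2 * \sum_(w : family) \sum_i (boundary_cell (scramble_cells w (a i)))%:R <=
    8 * C0 ^+ 2 * (n * (#|{: family}|%:R * (2 * d%:R * b%:R ^- N))) :> R.
  by rewrite ler_wpM2l // mulr_ge0 ?sqr_ge0.
apply: le_trans (lerD (lerD V2 (lexx _)) Bd2) _.
rewrite sumr_const -[_ *+ #|_|]mulr_natl le_eqVlt; apply/orP; left; apply/eqP.
ring.
Qed.

End PairMSE.

(** * The rate in terms of the number of points *)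

Section Rate.
Variables (R : realType) (d b lam t : nat) (M B : R).
Hypothesis hd : (0 < d)%N.
Hypothesis hb : (1 < b)%N.
Hypothesis hlam : (0 < lam < b)%N.
Hypothesis hM : 0 < M < 1 / 2.

(** Chosen so that exp(-(1/2 - M) r^2) = n^(-3/2). *)
Definition clip_radius (n : R) : R := Num.sqrt (3 * ln n / (1 - 2 * M)).

Definition rate_const : R :=
  2 * (lam%:R ^+ 3 * b%:R ^+ (3 * t + d) * (deriv_bound d M B * (2 * b%:R) ^+ d) ^+ 2 *
       (9 / ln 2) ^+ d) +
  36 * (4 * sup_const d B ^+ 2 + (deriv_bound d M B * d%:R) ^+ 2) +
  16 * d%:R * sup_const d B ^+ 2.

Let b0 : (0 : R) < b%:R. Proof. by rewrite ltr0n ltnW. Qed.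
Let lam0 : (0 : R) < lam%:R. Proof. by rewrite ltr0n; case/andP: hlam. Qed.
Let ln2 : 0 < ln 2 :> R. Proof. by rewrite ln_gt0 // ltr1n. Qed.
Let M0 : 0 < 1 - 2 * M.
Proof. by case/andP: hM => _ M2; lra. Qed.

Section Level.
Variable m : nat.
Let n : R := (lam * b ^ m)%:R.
Hypothesis m1 : (0 < m)%N.
Hypothesis ln_n1 : 1 <= ln n.

Let nE : n = lam%:R * b%:R ^+ m. Proof. by rewrite /n natrM natrX. Qed.
Let n0 : 0 < n. Proof. by rewrite nE mulr_gt0 // exprn_gt0. Qed.
Let n1 : 1 <= n.
Proof. by rewrite /n ler1n muln_gt0 expn_gt0 (ltnW hb); case/andP: hlam => ->. Qed.

(* This makes b^N >= n^4, while N is still of the order of ln n. *)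
Let N := (4 * m.+1)%N.

Lemma level_le_ln : m%:R * ln 2 <= ln n.
Proof.
have b2 : (2 : R) <= b%:R by rewrite ler_nat.
rewrite mulr_natl -lnXn // ler_ln ?posrE ?exprn_gt0 // nE.
apply: (@le_trans _ _ (b%:R ^+ m)); first by rewrite lerXn2r // nnegrE ltW.
by rewrite ler_peMl ?exprn_ge0 ?(ltW b0) // ler1n; case/andP: hlam.
Qed.

Let N_le : N.+1%:R <= 9 * m%:R :> R.
Proof. by rewrite -natrM ler_nat /N; move: m1; clear; case: m => // k _; lia. Qed.

Lemma digits_fine : b%:R ^- N <= n ^- 4.
Proof.
rewrite lef_pV2 ?posrE ?exprn_gt0 // /N exprM exprAC.
rewrite lerXn2r ?nnegrE ?exprn_ge0 ?(ltW b0) ?(ltW n0) //.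
rewrite nE exprS ler_wpM2r ?exprn_ge0 ?(ltW b0) // ler_nat.
by case/andP: hlam => _ /ltnW.
Qed.

Let L4 : n ^- 4 <= n ^- 3.
Proof. by rewrite lef_pV2 ?posrE ?exprn_gt0 // ler_weXn2l. Qed.

Lemma tail_error_sqr :
  tail_error d M B (clip_radius n) ^+ 2 = 4 * sup_const d B ^+ 2 * n ^- 3.
Proof.
rewrite /tail_error /clip_radius sqr_sqrtr; last first.
  by rewrite divr_ge0 ?(ltW M0) // mulr_ge0 // (le_trans ler01).
have -> : - ((1 / 2 - M) * (3 * ln n / (1 - 2 * M))) = - (ln n * (3%:R / 2)).
  by field; rewrite gt_eqF.
rewrite !exprMn -expRM_natl mulrN.
have -> : 2%:R * (ln n * (3%:R / 2)) = ln n *+ 3 by rewrite -mulr_natr; field.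
rewrite -lnXn // expRN lnK ?posrE ?exprn_gt0 //; ring.
Qed.

Variables (h : 'rV[R]_d -> R) (D : density_vector R d).
Hypothesis hq : Ge2 M B (h_over_g h D).
Variable L : R -> R.
Hypothesis gL : forall (j : 'I_d) (r x : R), `|x| <= r ->
  0 < g D j x /\ (g D j x)^-1 <= L r.
Variable Lam : R.
Hypothesis Lam1 : 1 <= Lam.
Hypothesis LLam : L (clip_radius n) <= Lam.
Variable x : 'I_(lam * b ^ m) -> 'rV[R]_d.
Hypothesis hx : is_net t x.
Context dT (T : measurableType dT) (P : probability T R).
Variable perms : 'I_d * seq 'I_b -> T -> 'S_b.
Hypothesis hperms : uniform_permutations P perms.
Context dW (TW : measurableType dW) (PW : probability TW R).
Variable W : 'I_d -> {RV PW >-> R}.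
Hypothesis hW : standard_normal_vector W.

(** The level sum has (N + 1)^d = O((ln n)^d) terms, the square of the truncation
    error is exactly of order n^-3, and the errors due to the digits beyond the
    N-th are of smaller order. *)
Lemma scrambled_mse_rate :
  (scrambled_mse hb P perms x W h D <=
   (rate_const * (n ^- 3 * ln n ^+ d * Lam ^+ (2 * d)))%:E)%E.
Proof.
have mN : (m <= N)%N by rewrite /N (leq_trans (leqnSn m)) // leq_pmull.
have r0 : 0 <= clip_radius n by exact: sqrtr_ge0.
have [tm _ _ _] := hx.
have lam_pos : (0 < lam)%N by case/andP: hlam.
apply: le_trans (pair_mse hb hd lam_pos mN hM hq gL r0 hx hperms hW Lam1 LLam) _.
rewrite lee_fin -/n.
set C0 := sup_const d B; set K0 := deriv_bound d M B.
have K00 : 0 <= K0 by exact: (deriv_bound_ge0 hM hq).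
set G := ln n ^+ d * Lam ^+ (2 * d).
have Lamd : 1 <= Lam ^+ (2 * d) by exact: exprn_ege1.
have lnd : 1 <= ln n ^+ d by exact: exprn_ege1.
have G1 : 1 <= G by rewrite /G -[leLHS]mulr1; apply: ler_pM.
have n3 : 0 <= n ^- 3 by rewrite invr_ge0 exprn_ge0 // ltW.
have Lr0 : 0 <= L (clip_radius n).
  have [|g0] := gL (Ordinal hd) (r := clip_radius n) (x := 0); first by rewrite normr0.
  by apply: le_trans; rewrite invr_ge0 ltW.
have -> : n ^- 3 * ln n ^+ d * Lam ^+ (2 * d) = n ^- 3 * G by rewrite mulrA.
have dist (u v w z : R) : (u + v + w) * z = u * z + v * z + w * z by ring.
rewrite /rate_const dist -/C0 -/K0; apply: lerD; first apply: lerD.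
- rewrite -[leRHS]mulrA ler_wpM2l //.
  have Nd : N.+1%:R ^+ d <= (9 / ln 2) ^+ d * ln n ^+ d :> R.
    have Nl : N.+1%:R <= 9 / ln 2 * ln n :> R.
      rewrite mulrAC ler_pdivlMr //.
      apply: (@le_trans _ _ (9 * (m%:R * ln 2))); last by rewrite ler_wpM2l ?level_le_ln.
      by rewrite mulrA; apply: ler_wpM2r N_le; exact: ltW.
    by rewrite -exprMn; apply: lerXn2r; rewrite ?nnegrE ?ler0n // (le_trans (ler0n _ _) Nl).
  have -> : N.+1%:R ^+ d * (lam * b ^ (t + d))%:R / n *
      (K0 * (2 * b%:R * Lam) ^+ d / b%:R ^+ (m - t)) ^+ 2 =
    N.+1%:R ^+ d * (lam%:R ^+ 3 * b%:R ^+ (3 * t + d) * (K0 * (2 * b%:R) ^+ d) ^+ 2 *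
      n ^- 3 * Lam ^+ (2 * d)).
    have -> : n = lam%:R * b%:R ^+ t * b%:R ^+ (m - t).
      by rewrite nE -{1}(subnKC tm) exprD mulrA.
    rewrite natrM natrX (mulnC 2) (exprM Lam) !exprMn exprD (exprD _ (3 * t)) (mulnC 3) (exprM _ t).
    field.
    by rewrite !gt_eqF // exprn_gt0.
  apply: le_trans (ler_wpM2r _ Nd) _.
    rewrite mulr_ge0 ?exprn_ge0 ?(le_trans ler01 Lam1) // mulr_ge0 //.
    rewrite mulr_ge0 ?sqr_ge0 // mulr_ge0 ?exprn_ge0 ?(ltW b0) ?(ltW lam0) //.
  by rewrite /G le_eqVlt; apply/orP; left; apply/eqP; ring.
- have -> : 36 = 18 * 2 :> R by ring.
  rewrite -[leRHS]mulrA -[leRHS]mulrA ler_wpM2l //.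
  apply: (@le_trans _ _ (2 * (tail_error d M B (clip_radius n) ^+ 2 +
      cell_error d b N M B L (clip_radius n) ^+ 2))).
    set u := tail_error _ _ _ _; set v := cell_error _ _ _ _ _ _ _.
    by have := sqr_ge0 (u - v); nra.
  rewrite ler_wpM2l // tail_error_sqr [leRHS]mulrDl; apply: lerD.
    by apply: ler_wpM2l; [rewrite mulr_ge0 ?sqr_ge0|rewrite ler_peMr].
  rewrite /cell_error -/K0 mulrA [_ ^+ 2]exprMn.
  rewrite ler_wpM2l ?sqr_ge0 // exprMn mulrC.
  apply: ler_pM; rewrite ?sqr_ge0 //.
    apply: le_trans L4; apply: le_trans digits_fine.
    rewrite expr2 ler_piMl // ?invr_ge0 ?exprn_ge0 ?(ltW b0) //.
    by rewrite invf_le1 ?exprn_gt0 // exprn_ege1 // ler1n ltnW.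
  apply: (@le_trans _ _ (Lam ^+ (2 * d))); last first.
    by rewrite /G ler_peMl // (le_trans ler01).
  apply: (@le_trans _ _ (Lam ^+ 2)).
    by rewrite lerXn2r ?nnegrE // (le_trans ler01).
  by apply: ler_weXn2l => //; rewrite leq_pmulr.
- have -> : 8 * C0 ^+ 2 * (n * (2 * d%:R * b%:R ^- N)) =
      16 * d%:R * C0 ^+ 2 * (n * b%:R ^- N) by ring.
  apply: ler_wpM2l; first by rewrite mulr_ge0 ?sqr_ge0.
  apply: (@le_trans _ _ (n * n ^- 4)).
    by rewrite ler_wpM2l ?(ltW n0) // digits_fine.
  rewrite (_ : n * n ^- 4 = n ^- 3); last first.
    by rewrite exprS invfM mulrA divff ?mul1r // gt_eqF.
  by rewrite ler_peMr.
Qed.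

End Level.
End Rate.

(** * The two classes of integrands *)

Section Classes.
Variables (R : realType) (d b lam t : nat).
Hypothesis hd : (0 < d)%N.
Hypothesis hb : (1 < b)%N.
Hypothesis hlam : (0 < lam < b)%N.
Variables (k M B A c1 c2 : R).
Hypothesis hk : 0 < k.
Hypothesis hM : 0 < M < 1 / 2.
Hypothesis hc1 : 0 < c1.
Hypothesis hc2 : 0 < c2.

Let M0 : 0 < 1 - 2 * M.
Proof. by case/andP: hM => _ M2; lra. Qed.

Lemma near_large_n : \forall m \near \oo,
  (0 < m)%N /\ 1 <= ln (lam * b ^ m)%:R :> R.
Proof.
have ln2 : 0 < ln 2 :> R by rewrite ln_gt0 // ltr1n.
near=> m.
have m1 : (0 < m)%N by near: m; exact: nbhs_infty_gt.
split=> //; apply: le_trans (level_le_ln R hb hlam m).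
rewrite -ler_pdivrMr // mul1r; near: m; exact: nbhs_infty_ger.
Unshelve. all: by end_near. Qed.

Section Size.
Variable n : R.
Hypothesis ln_n1 : 1 <= ln n.

Let r := clip_radius M n.

Lemma clip_radius_sqr : r ^+ 2 = 3 * ln n / (1 - 2 * M).
Proof.
by rewrite sqr_sqrtr // divr_ge0 ?(ltW M0) // mulr_ge0 // (le_trans ler01).
Qed.

Lemma clip_radius_ge1 : 1 <= r.
Proof.
rewrite -(ler_pXn2r (n := 2)) ?nnegrE ?sqrtr_ge0 // expr1n clip_radius_sqr.
rewrite ler_pdivlMr // mul1r; have /andP[M1 _] := hM; move: M1 ln_n1; set l := ln n; lra.
Qed.

Lemma clip_radius_powR s : r `^ s = (3 * ln n / (1 - 2 * M)) `^ (s / 2).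
Proof.
rewrite /r /clip_radius -powR12_sqrt; last first.
  by rewrite divr_ge0 ?(ltW M0) // mulr_ge0 // (le_trans ler01).
by rewrite -powRrM; congr (_ `^ _); rewrite mulrC.
Qed.

Lemma clip_radius_powR_ge1 : 1 <= r `^ k.
Proof. by rewrite -(powRr0 r) ler_powR ?clip_radius_ge1 // ltW. Qed.

(** The factor c1 r^k + c2 is at most (1 + c1 + c2) r^k as r >= 1, and r^2 is
    proportional to ln n: each of the 2 d factors costs (ln n)^(k / 2). *)
Lemma polynomial_factor :
  ln n ^+ d * ((1 + c1 + c2) * r `^ k) ^+ (2 * d) =
  (1 + c1 + c2) ^+ (2 * d) * (3 / (1 - 2 * M)) `^ (k * d%:R) *
  ln n `^ ((k + 1) * d%:R).
Proof.
have l0 : 0 <= ln n := le_trans ler01 ln_n1.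
rewrite exprMn mulrCA -mulrA; congr (_ * _).
have -> : r `^ k ^+ (2 * d) = (3 / (1 - 2 * M)) `^ (k * d%:R) * ln n `^ (k * d%:R).
  rewrite -powRM // ?divr_ge0 ?(ltW M0) // -powR_mulrn ?powR_ge0 // -powRrM.
  rewrite clip_radius_powR; congr (_ `^ _); first by ring.
  by rewrite natrM; field.
rewrite mulrCA; congr (_ * _); rewrite -powR_mulrn // -powRD; last first.
  by apply/implyP => _; rewrite gt_eqF // (lt_le_trans ltr01).
by congr (_ `^ _); ring.
Qed.

Lemma exponential_factor :
  ((1 + c2) * expR (c1 * r `^ k)) ^+ (2 * d) =
  (1 + c2) ^+ (2 * d) *
  expR (2 * d%:R * c1 * (3 * ln n / (1 - 2 * M)) `^ (k / 2)).
Proof.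
rewrite exprMn -expRM_natl natrM clip_radius_powR; congr (_ * expR _); ring.
Qed.

End Size.

Lemma V_p_growth (h : 'rV[R]_d -> R) (D : density_vector R d) : V_p M B A c1 c2 k h D ->
  forall j (r x : R), `|x| <= r -> 0 < g D j x /\ (g D j x)^-1 <= c1 * r `^ k + c2.
Proof.
move=> [_ gV _] j r x xr; have [g0 gx] := gV j x.
split; first exact: g0.
apply: (le_trans gx); rewrite lerD2r ler_wpM2l ?(ltW hc1) //.
by rewrite ge0_ler_powR ?(ltW hk) ?nnegrE // (le_trans _ xr).
Qed.

Lemma V_e_growth (h : 'rV[R]_d -> R) (D : density_vector R d) : V_e M B A c1 c2 k h D ->
  forall j (r x : R), `|x| <= r -> 0 < g D j x /\ (g D j x)^-1 <= c2 * expR (c1 * r `^ k).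
Proof.
move=> [_ gV _] j r x xr; have [g0 gx] := gV j x.
split; first exact: g0.
apply: (le_trans gx); rewrite ler_wpM2l ?(ltW hc2) // ler_expR ler_wpM2l ?(ltW hc1) //.
by rewrite ge0_ler_powR ?(ltW hk) ?nnegrE // (le_trans _ xr).
Qed.

End Classes.

Theorem theorem5p10 (R : realType) (d b lam t : nat)
    (hd : (0 < d)%N) (hb : (1 < b)%N) (hlam : (1 <= lam < b)%N)
    (k M B A M1 B1 M2 B2 : R)
    (hk : 0 < k) (hM : 0 < M < 1 / 2) (hB : 0 < B) (hA : 0 < A)
    (hM1 : 0 < M1) (hB1 : 0 < B1) (hM2 : 0 < M2) (hB2 : 0 < B2)
    (dW : measure_display) (TW : measurableType dW) (PW : probability TW R)
    (W : 'I_d -> {RV PW >-> R}) (hW : standard_normal_vector W) :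
  (exists C : R, \forall m \near \oo,
     forall (dT : measure_display) (T : measurableType dT)
       (P : probability T R) (perms : 'I_d * seq 'I_b -> T -> 'S_b)
       (x : 'I_(lam * b ^ m) -> 'rV[R]_d),
     uniform_permutations P perms -> is_net t x ->
     let n : R := (lam * b ^ m)%:R in
     (sup_scrambled_mse hb P perms x W (V_p M B A M1 B1 k)
      <= (C * (n ^- 3 * ln n `^ ((k + 1) * d%:R)))%:E)%E) /\
  (exists C : R, \forall m \near \oo,
     forall (dT : measure_display) (T : measurableType dT)
       (P : probability T R) (perms : 'I_d * seq 'I_b -> T -> 'S_b)
       (x : 'I_(lam * b ^ m) -> 'rV[R]_d),
     uniform_permutations P perms -> is_net t x ->
     let n : R := (lam * b ^ m)%:R in
     (sup_scrambled_mse hb P perms x W (V_e M B A M2 B2 k)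
      <= (C * (n ^- 3 * ln n ^+ d *
               expR (2 * d%:R * M2 *
                     (3 * ln n / (1 - 2 * M)) `^ (k / 2))))%:E)%E).
Proof.
have large := near_large_n R hb hlam.
split.
- exists (rate_const d b lam t M B *
    ((1 + M1 + B1) ^+ (2 * d) * (3 / (1 - 2 * M)) `^ (k * d%:R))).
  near=> m; have [m1 ln1] : (0 < m)%N /\ 1 <= ln (lam * b ^ m)%:R :> R by near: m.
  move=> dT T P perms x hperms hx; set n : R := (lam * b ^ m)%:R.
  apply: ge_ereal_sup => _ [h [D [hV ->]]]; have [hq _ _] := hV.
  have r1 : 1 <= clip_radius M n `^ k := clip_radius_powR_ge1 hk hM ln1.
  have c1 : 1 <= (1 + M1 + B1) * clip_radius M n `^ k.
    by rewrite -[leLHS]mulr1 ler_pM //; lra.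
  have c2 : M1 * clip_radius M n `^ k + B1 <= (1 + M1 + B1) * clip_radius M n `^ k.
    nra.
  have := scrambled_mse_rate hd hb hlam hM m1 ln1 hq (V_p_growth hk hM1 hV)
    c1 c2 hx hperms hW.
  move=> /le_trans; apply; rewrite lee_fin -/n.
  have E := polynomial_factor d k M1 B1 hM ln1.
  rewrite -mulrA E le_eqVlt; apply/orP; left; apply/eqP; ring.
- exists (rate_const d b lam t M B * (1 + B2) ^+ (2 * d)).
  near=> m; have [m1 ln1] : (0 < m)%N /\ 1 <= ln (lam * b ^ m)%:R :> R by near: m.
  move=> dT T P perms x hperms hx; set n : R := (lam * b ^ m)%:R.
  apply: ge_ereal_sup => _ [h [D [hV ->]]]; have [hq _ _] := hV.
  set e := expR (M2 * clip_radius M n `^ k).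
  have e1 : 1 <= e.
    by rewrite /e -[leLHS]expR0 ler_expR mulr_ge0 ?(ltW hM2) // powR_ge0.
  have c1 : 1 <= (1 + B2) * e by rewrite -[leLHS]mulr1 ler_pM //; lra.
  have c2 : B2 * e <= (1 + B2) * e by nra.
  have := scrambled_mse_rate hd hb hlam hM m1 ln1 hq (V_e_growth hk hM2 hB2 hV)
    c1 c2 hx hperms hW.
  move=> /le_trans; apply; rewrite lee_fin -/n /e.
  have E := exponential_factor d k M2 B2 hM ln1.
  rewrite E le_eqVlt; apply/orP; left; apply/eqP; ring.
Unshelve. all: by end_near. Qed.
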